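(* Let $A$ be an $\mathcal{O}$-Tambara functor and let $B$ be an $A$-algebra. Let $\mathsf{D}$ be the full subcategory of $(A\text{-}\mathsf{CAlg}/B)_{ab}$ consisting of those objects such that the kernel of the map to $B$ has vanishing norms for all 2-surjective admissible maps. Then $\mathsf{D}$ is equivalent to the category of $B$-modules, the two inverse functors being the equivariant square-zero extension $M\mapsto B\ltimes M$ and the augmentation ideal.
   Context: Let $G$ be a finite group. An indexing system $\mathcal{O}$ assigns to each subgroup $H\le G$ a class $\mathcal{O}(G/H)$ of finite $H$-sets, closed under isomorphism, restriction, conjugation and disjoint union, containing all trivial $H$-sets, closed under finite limits, and closed under self-induction: if $H/K\in\mathcal{O}(G/H)$ and $T\in\mathcal{O}(G/K)$ then $H\times_K T\in\mathcal{O}(G/H)$. A map $f:X\to Y$ of finite $G$-sets is admissible if $G_{f(x)}/G_x\in\mathcal{O}(G/G_{f(x)})$ for all $x\in X$. An $\mathcal{O}$-Tambara functor is a commutative Green functor $R$ for $G$ (a commutative monoid in Mackey functors under the box product; transfers $T_f$, restrictions $R_f$) together with multiplicative norm maps $N_f:R(X)\to R(Y)$ for each admissible $f:X\to Y$, functorial in $f$, equal to multiplication for fold maps, and satisfying the double coset formulas and Tambara reciprocity. Modules over $R$ are modules over the underlying Green functor. $A\text{-}\mathsf{CAlg}$ is the category of $\mathcal{O}$-Tambara functors under $A$; $A\text{-}\mathsf{CAlg}/B$ is the category of $A$-algebras over $B$; $(A\text{-}\mathsf{CAlg}/B)_{ab}$ is its category of abelian group objects. A map of finite $G$-sets is 2-surjective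 if every fiber has at least 2 elements. The augmentation ideal of $R\to B$ is $\ker(R\to B)$, which for an abelian group object is a $B$-module via the unit $B\to R$. The square-zero extension $B\ltimes M$ of $B$ by a $B$-module $M$ is $B\oplus M$ as a Mackey functor, with norms for admissible $f:X\to Y$ $$N_f(b,m)=\big(N_f(b),\,T_f(N_{\pi_1}R_{\pi_2}(b)\cdot m)\big),$$ where $\pi_1,\pi_2:(X\times_Y X)\setminus\Delta(X)\to X$ are the two projections (for the fold map this gives $(b,m)(b',m')=(bb',bm'+b'm)$); it is an abelian group object over $B$ via $((b,m),(b,m'))\mapsto(b,m+m')$, with $A$-algebra structure via $A\to B$. *)

(* Defs.v *)
From HB Require Import structures.
From mathcomp Require Import all_boot all_algebra all_fingroup.
From mathcomp Require Import boolp.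

Set Implicit Arguments.
Unset Strict Implicit.
Unset Printing Implicit Defensive.

Import GRing.Theory.

#[local] Obligation Tactic := idtac.

(* Actions are right actions, as everywhere in MathComp.  The values of an
   [action H T] outside H are irrelevant: equivariance is only required on H. *)
Record hset (gT : finGroupType) (H : {group gT}) := HSet {
  hset_sort :> finType;
  hset_act : action H hset_sort
}.

Definition hact (gT : finGroupType) (H : {group gT}) (X : hset H) (x : X)
  (a : gT) : X := hset_act X x a.

Section HSets.
Local Open Scope group_scope.
Variable gT : finGroupType.
Implicit Types H K : {group gT}.

Lemma hact1 H (X : hset H) (x : X) : hact x 1 = x.
Proof. exact: act1. Qed.

Lemma hactM H (X : hset H) (x : X) a b :
  a \in H -> b \in H -> hact x (a * b) = hact (hact x a) b.
Proof. by move=> ha hb; rewrite /hact actMin. Qed.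

Section Make.
Variables (H : {group gT}) (T : finType) (to : T -> gT -> T).
Hypothesis to1 : forall x, to x 1 = x.
Hypothesis toM : forall x a b, a \in H -> b \in H ->
  to x (a * b) = to (to x a) b.

Let mk_act x a := if a \in H then to x a else x.

Lemma mk_actP : is_action H mk_act.
Proof.
split=> [a x y|x a b ha hb]; rewrite /mk_act; last by rewrite groupM ?ha ?hb ?toM.
case: ifP => // ha e; rewrite -[x]to1 -[y]to1 -(mulgV a) !toM ?groupV //.
by rewrite e.
Qed.

Definition mk_hset : hset H := HSet (Action mk_actP).

Lemma mk_hsetE (x : mk_hset) a : a \in H -> hact x a = to x a.
Proof. by move=> ha; rewrite /hact /= /mk_act ha. Qed.
End Make.

Record hmap H (X Y : hset H) := HMap {
  hmap_fun :> X -> Y;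
  hmapP : forall x a, a \in H -> hmap_fun (hact x a) = hact (hmap_fun x) a
}.

Lemma hmap_eq H (X Y : hset H) (f g : hmap X Y) : f =1 g -> f = g.
Proof.
case: f g => [f hf] [g hg] /= /funext e; case: g / e hg => hg.
by congr HMap; exact: Prop_irrelevance.
Qed.

Definition hid H (X : hset H) : hmap X X := @HMap H X X id (fun _ _ _ => erefl).

Program Definition hcomp H (X Y Z : hset H) (g : hmap Y Z) (f : hmap X Y) :
  hmap X Z := @HMap H X Z (g \o f) _.
Next Obligation. by move=> H X Y Z g f x a ha /=; rewrite !hmapP. Qed.

Definition htriv H (T : finType) : hset H :=
  @mk_hset H T (fun x _ => x) (fun _ => erefl) (fun _ _ _ _ _ => erefl).

Program Definition hres H K (sKH : K \subset H) (X : hset H) : hset K :=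
  @mk_hset K X (@hact _ _ X) (@hact1 H X) _.
Next Obligation.
by move=> H K sKH X x a b ha hb; rewrite hactM ?(subsetP sKH).
Qed.

Program Definition hconj H (g : gT) (X : hset H) : hset (H :^ g)%G :=
  @mk_hset (H :^ g)%G X (fun x a => hact x (a ^ g^-1)) _ _.
Next Obligation. by move=> H g X x /=; rewrite conj1g hact1. Qed.
Next Obligation.
by move=> H g X x a b /=; rewrite !mem_conjg => ha hb; rewrite conjMg hactM.
Qed.

Program Definition hsum H (X Y : hset H) : hset H :=
  @mk_hset H (X + Y)%type (fun s a =>
    match s with inl x => inl (hact x a) | inr y => inr (hact y a) end) _ _.
Next Obligation. by move=> H X Y [x|x] /=; rewrite hact1. Qed.
Next Obligation. by move=> H X Y [x|x] a b ha hb /=; rewrite hactM. Qed.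

Program Definition hinl H (X Y : hset H) : hmap X (hsum X Y) :=
  @HMap H X (hsum X Y) inl _.
Next Obligation. by move=> H X Y x a ha; rewrite mk_hsetE. Qed.

Program Definition hinr H (X Y : hset H) : hmap Y (hsum X Y) :=
  @HMap H Y (hsum X Y) inr _.
Next Obligation. by move=> H X Y x a ha; rewrite mk_hsetE. Qed.

Program Definition hfold H (X : hset H) : hmap (hsum X X) X :=
  @HMap H (hsum X X) X (fun s => match s with inl x => x | inr x => x end) _.
Next Obligation. by move=> H X [x|x] a ha; rewrite mk_hsetE. Qed.

(* H/K, realised for right actions as the set of cosets K h with h in H. *)
Definition coset_space H K := {C : {set gT} | C \in rcosets K H}.

Definition coset_act H K (C : coset_space H K) (a : gT) : coset_space H K :=
  insubd C (val C :* a).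

Lemma val_coset_act H K (C : coset_space H K) a :
  a \in H -> val (coset_act C a) = val C :* a.
Proof.
move=> ha; rewrite val_insubd; case: ifP => //.
have /rcosetsP[h hh ->] := valP C.
by rewrite -rcosetM mem_rcosets (subsetP (mulG_subr K H)) ?groupM.
Qed.

Program Definition hcoset H K : hset H :=
  @mk_hset H (coset_space H K) (@coset_act H K) _ _.
Next Obligation.
by move=> H K C /=; apply: val_inj; rewrite val_coset_act // mulg1.
Qed.
Next Obligation.
move=> H K C a b ha hb; apply: val_inj.
by rewrite !val_coset_act ?groupM // rcosetM.
Qed.

(* U, with q(t, h) the class of (t, h), is the induced H-set
   T x_K H = (T x H)/((t k, h) ~ (t, k h)). *)
Definition is_induced H K (T : hset K) (U : hset H) (q : T -> gT -> U) : Prop :=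
  [/\ forall t, {in H &, forall h a, q t (h * a) = hact (q t h) a},
      forall u, exists t, exists2 h, h \in H & q t h = u
    & forall t t', {in H &, forall h h',
        q t h = q t' h' <->
        exists2 k, k \in K & t' = hact t k /\ h = k * h'}].

(* L, with projections p, is the limit of the finite diagram with vertices F
   and edges u. *)
Definition is_limit H (J E : finType) (s t : E -> J) (F : J -> hset H)
    (u : forall e, hmap (F (s e)) (F (t e))) (L : hset H)
    (p : forall j, hmap L (F j)) : Prop :=
  (forall e l, u e (p (s e) l) = p (t e) l) /\
  (forall x : (forall j, F j), (forall e, u e (x (s e)) = x (t e)) ->
     exists! l, forall j, p j l = x j).

End HSets.

Record indexing_system (gT : finGroupType) := IndexingSystem {
  ix_mem :> forall H : {group gT}, hset H -> Prop;
  ix_iso : forall (H : {group gT}) (S T : hset H) (f : hmap S T),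
    bijective f -> ix_mem S -> ix_mem T;
  ix_res : forall (H K : {group gT}) (sKH : K \subset H) (T : hset H),
    ix_mem T -> ix_mem (hres sKH T);
  ix_conj : forall (H : {group gT}) (g : gT) (T : hset H),
    ix_mem T -> ix_mem (hconj g T);
  ix_sum : forall (H : {group gT}) (S T : hset H),
    ix_mem S -> ix_mem T -> ix_mem (hsum S T);
  ix_triv : forall (H : {group gT}) (T : finType), ix_mem (htriv H T);
  ix_lim : forall (H : {group gT}) (J E : finType) (s t : E -> J)
      (F : J -> hset H) (u : forall e, hmap (F (s e)) (F (t e)))
      (L : hset H) (p : forall j, hmap L (F j)),
    is_limit u p -> (forall j, ix_mem (F j)) -> ix_mem L;
  ix_ind : forall (H K : {group gT}) (T : hset K) (U : hset H)
      (q : T -> gT -> U),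
    K \subset H -> is_induced q ->
    ix_mem (hcoset H K) -> ix_mem T -> ix_mem U
}.

Notation gset gT := (hset [set: gT]%G).
Notation gmap X Y := (@hmap _ [set: _]%G X Y).

Section GSets.
Variable gT : finGroupType.
Implicit Types X Y Z W : gset gT.

Definition gstab X (x : X) : {group gT} := 'C[x | hset_act X]%G.

Definition is_pullback X Y Z W (f : gmap X Z) (g : gmap Y Z)
    (f' : gmap W Y) (g' : gmap W X) : Prop :=
  (forall w, f (g' w) = g (f' w)) /\
  (forall x y, f x = g y -> exists! w, g' w = x /\ f' w = y).

(* The exponential diagram

       S <--e-- P --p--> Z
       |h       |k       |q       (h e = k, and P is the pullback of f and q)
       v        v        v
       X ====== X --f--> Y

   where Z is the dependent product of S along f: its points over y are the
   sections s of h over the fibre of f at y, and e is evaluation. *)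
Definition is_exponential S X Y Z P (h : gmap S X) (f : gmap X Y)
    (q : gmap Z Y) (p : gmap P Z) (k : gmap P X) (e : gmap P S) : Prop :=
  [/\ is_pullback f q p k,
      forall w, h (e w) = k w
    & forall y (s : {x : X | f x == y} -> S), (forall x, h (s x) = val x) ->
        exists! z, q z = y /\
          forall w (x : {x : X | f x == y}), p w = z -> k w = val x -> e w = s x].

Definition two_surjective X Y (f : gmap X Y) : Prop :=
  forall y, (2 <= #|[set x | f x == y]|)%N.

Definition admissible (O : indexing_system gT) X Y (f : gmap X Y) : Prop :=
  forall x, O _ (hcoset (gstab (f x)) (gstab x)).

(* offdiag f is (X x_Y X) minus the diagonal, with projections offdiag1 and
   offdiag2. *)
Section OffDiagonal.
Variables (X Y : gset gT) (f : gmap X Y).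

Definition offdiag_type := {p : X * X | (f p.1 == f p.2) && (p.1 != p.2)}.

Definition offdiag_act (p : offdiag_type) (a : gT) : offdiag_type :=
  insubd p (hact (val p).1 a, hact (val p).2 a).

Lemma val_offdiag_act p a :
  val (offdiag_act p a) = (hact (val p).1 a, hact (val p).2 a).
Proof.
rewrite val_insubd; case: ifP => // /negP[].
have /andP[/eqP e n] := valP p; rewrite /= !hmapP ?inE // e eqxx /=.
by rewrite /hact (inj_eq (act_inj _ a)).
Qed.

Program Definition offdiag : gset gT :=
  @mk_hset gT _ offdiag_type offdiag_act _ _.
Next Obligation.
move=> p; apply: val_inj; rewrite val_offdiag_act !hact1.
by case: (val p).
Qed.
Next Obligation.
by move=> p a b ha hb; apply: val_inj; rewrite !val_offdiag_act /= !hactM.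
Qed.

Program Definition offdiag1 : gmap offdiag X :=
  @HMap gT _ offdiag X (fun p => (val p).1) _.
Next Obligation.
by move=> p a ha; rewrite mk_hsetE // val_offdiag_act.
Qed.

Program Definition offdiag2 : gmap offdiag X :=
  @HMap gT _ offdiag X (fun p => (val p).2) _.
Next Obligation.
by move=> p a ha; rewrite mk_hsetE // val_offdiag_act.
Qed.

End OffDiagonal.

Local Open Scope group_scope.

Lemma gstabP X (x : X) a : reflect (hact x a = x) (a \in gstab x).
Proof. by apply: (iffP astab1P); rewrite ?inE. Qed.

(* Any f' occurring in a commutative square f g' = g f' with (g', f') jointly
   injective is admissible as soon as f is: the orbit of g' w under the
   stabiliser of f' w is a subobject of a restriction of an admissible orbit. *)
Lemma admissible_base (O : indexing_system gT) X Y Z W (f : gmap X Z)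
    (g : gmap Y Z) (f' : gmap W Y) (g' : gmap W X) :
  (forall w, f (g' w) = g (f' w)) ->
  (forall w w', g' w = g' w' -> f' w = f' w' -> w = w') ->
  admissible O f -> admissible O f'.
Proof.
move=> sq inj adm w.
set H := gstab (f' w); set K := gstab w.
have sHL : H \subset gstab (f (g' w)).
  apply/subsetP => a /gstabP e; apply/gstabP.
  by rewrite sq -hmapP ?inE // e.
set L := gstab (f (g' w)) in sHL; set M := gstab (g' w).
have KE a : (a \in K) = (a \in H) && (a \in M).
  apply/gstabP/andP => [e|[/gstabP e1 /gstabP e2]].
    by split; apply/gstabP; rewrite -hmapP ?inE // e.
  by apply: inj; rewrite hmapP ?inE.
pose T := hres sHL (hcoset L M).
have ML C : C \in rcosets K H -> M * C \in rcosets M L.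
  case/rcosetsP => h hh ->; apply/rcosetsP; exists h; first exact: (subsetP sHL).
  rewrite mulgA; congr (_ * _); apply/eqP; rewrite eqEsubset mulG_subl andbT.
  by rewrite mulG_subG subxx; apply/subsetP => a; rewrite KE => /andP[].
pose m0 (C : hcoset H K) : T := exist _ (M * val C) (ML _ (valP C)).
have m0P C a : a \in H -> m0 (hact C a) = hact (m0 C) a.
  move=> ha; have haL := subsetP sHL _ ha; apply: val_inj.
  rewrite [in RHS]mk_hsetE // mk_hsetE // /m0 /= !mk_hsetE // !val_coset_act //.
  by rewrite mulgA.
pose m := HMap m0P.
have m_inj : injective m.
  move=> C D /(congr1 val) /= e; apply: val_inj.
  have /rcosetsP[c hc eC] := valP C; have /rcosetsP[d hd eD] := valP D.
  rewrite eC eD; apply/rcoset_eqP; rewrite mem_rcoset KE groupM ?groupV //=.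
  have : c \in M * val D by rewrite -e eC; rewrite -[c]mul1g mem_mulg // mul1g rcoset_refl.
  rewrite eD mulgA => /mulsgP[x y /mulsgP[u v hu hv ->]].
  rewrite inE => /eqP -> ->; rewrite mulgK groupM //.
  by move: hv; rewrite KE => /andP[].
pose chi0 (t : T) : htriv H bool := t \in codom m.
have chi0P t a : a \in H -> chi0 (hact t a) = hact (chi0 t) a.
  move=> ha; rewrite [in RHS]mk_hsetE //.
  suff e : (hact t a \in codom m) = (t \in codom m) by exact: e.
  apply/codomP/codomP => -[C e].
    exists (hact C a^-1); rewrite hmapP ?groupV // -e -hactM ?groupV //.
    by rewrite mulgV hact1.
  by exists (hact C a); rewrite hmapP // e.
have cstP (S : hset H) (x : S) a : a \in H ->
    (fun=> true : htriv H bool) (hact x a) = hact (true : htriv H bool) a.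
  by move=> ha; rewrite mk_hsetE.
pose cst S := @HMap gT H S (htriv H bool) (fun=> true) (@cstP S).
pose F (j : bool) := if j then T else htriv H bool.
pose u (e : bool) : hmap (F true) (F false) :=
  if e then HMap chi0P else cst T.
pose p (j : bool) : hmap (hcoset H K) (F j) :=
  if j return hmap (hcoset H K) (F j) then m else cst (hcoset H K).
apply: (@ix_lim _ O H bool bool (fun=> true) (fun=> false) F u _ p).
  split=> [[] l //=|x hx]; first exact: codom_f.
  have e2 := hx false; have e1 := hx true; rewrite -e2 /= in e1.
  have /codomP[l el] : x true \in codom m by rewrite /= in e1; exact: e1.
  exists l; split=> [[]|l' /(_ true)] /=; first by rewrite el.
    exact: e2.
  by rewrite el => /m_inj.
case; last exact: ix_triv.
by apply: ix_res; exact: adm.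
Qed.

Lemma offdiag1_admissible (O : indexing_system gT) X Y (f : gmap X Y) :
  admissible O f -> admissible O (offdiag1 f).
Proof.
apply: (@admissible_base O X X Y _ f f _ (offdiag2 f)) => [w|w w' e2 e1].
  by have /andP[/eqP] := valP w.
by apply: val_inj; rewrite [LHS]surjective_pairing [RHS]surjective_pairing; congr pair.
Qed.

End GSets.

Record cat := Cat {
  ob :> Type;
  hom : ob -> ob -> Type;
  idm : forall x, hom x x;
  comp : forall x y z, hom y z -> hom x y -> hom x z;
  comp_idl : forall x y (f : hom x y), comp (idm y) f = f;
  comp_idr : forall x y (f : hom x y), comp f (idm x) = f;
  compA : forall x y z t (h : hom z t) (g : hom y z) (f : hom x y),
    comp h (comp g f) = comp (comp h g) f
}.
Arguments idm {c} x.

Declare Scope cat_scope.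
Delimit Scope cat_scope with C.
Local Notation "g \c f" := (comp g f)
  (at level 40, left associativity) : cat_scope.

Record functor (C D : cat) := Functor {
  fob :> C -> D;
  fmap : forall x y, hom x y -> hom (fob x) (fob y);
  fmap_id : forall x, fmap (idm x) = idm (fob x);
  fmap_comp : forall x y z (g : hom y z) (f : hom x y),
    fmap (comp g f) = comp (fmap g) (fmap f)
}.

Section Categories.
Local Open Scope cat_scope.

Program Definition functor_id (C : cat) : functor C C :=
  @Functor C C id (fun _ _ => id) _ _.
Solve All Obligations with by [].

Program Definition functor_comp (C D E : cat) (G : functor D E)
  (F : functor C D) : functor C E :=
  @Functor C E (G \o F) (fun x y f => fmap G (fmap F f)) _ _.
Next Obligation. by move=> C D E G F x /=; rewrite !fmap_id. Qed.
Next Obligation. by move=> C D E G F x y z g f /=; rewrite !fmap_comp. Qed.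

Definition nat_isomorphic (C D : cat) (F G : functor C D) : Prop :=
  exists (u : forall x, hom (F x) (G x)) (v : forall x, hom (G x) (F x)),
    [/\ forall x, u x \c v x = idm _,
        forall x, v x \c u x = idm _
      & forall x y (f : hom x y), u y \c fmap F f = fmap G f \c u x].

Definition inverse_equivalences (C D : cat) (F : functor C D)
    (G : functor D C) : Prop :=
  nat_isomorphic (functor_comp G F) (functor_id C) /\
  nat_isomorphic (functor_comp F G) (functor_id D).

Program Definition full_subcat (C : cat) (P : C -> Prop) : cat :=
  @Cat {x : C | P x} (fun x y => hom (sval x) (sval y)) (fun x => idm (sval x))
    (fun x y z g f => g \c f) _ _ _.
Next Obligation. by move=> *; exact: comp_idl. Qed.
Next Obligation. by move=> *; exact: comp_idr. Qed.
Next Obligation. by move=> *; exact: compA. Qed.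

Section Coslice.
Variables (C : cat) (a : C).

Record under_ob := Under { u_ob :> C; u_map : hom a u_ob }.

Record under_hom (x y : under_ob) := UnderHom {
  under_fun : hom x y;
  under_funP : under_fun \c u_map x = u_map y
}.
Arguments UnderHom {x y} under_fun _.

Lemma under_eq (x y : under_ob) (f g : under_hom x y) :
  under_fun f = under_fun g -> f = g.
Proof.
case: f g => [f hf] [g hg] /= e; case: g / e hg => hg.
by congr UnderHom; exact: Prop_irrelevance.
Qed.

Program Definition coslice : cat :=
  @Cat under_ob under_hom (fun x => UnderHom (idm (u_ob x)) _)
    (fun x y z g f => UnderHom (under_fun g \c under_fun f) _) _ _ _.
Next Obligation. by move=> x /=; rewrite comp_idl. Qed.
Next Obligation. by move=> x y z g f /=; rewrite -compA !(under_funP f, under_funP g). Qed.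
Next Obligation. by move=> x y f; apply: under_eq; rewrite /= comp_idl. Qed.
Next Obligation. by move=> x y f; apply: under_eq; rewrite /= comp_idr. Qed.
Next Obligation. by move=> *; apply: under_eq; rewrite /= compA. Qed.

Lemma coslice_compE (x y z : coslice) (g : hom y z) (f : hom x y) :
  under_fun (g \c f) = under_fun g \c under_fun f.
Proof. by []. Qed.
End Coslice.
#[global] Arguments UnderHom {C a x y} under_fun _.
#[global] Arguments under_fun {C a x y} _.

Section Slice.
Variables (C : cat) (b : C).

Record over_ob := Over { o_ob :> C; o_map : hom o_ob b }.

Record over_hom (x y : over_ob) := OverHom {
  over_fun : hom x y;
  over_funP : o_map y \c over_fun = o_map x
}.
Arguments OverHom {x y} over_fun _.

Lemma over_eq (x y : over_ob) (f g : over_hom x y) :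
  over_fun f = over_fun g -> f = g.
Proof.
case: f g => [f hf] [g hg] /= e; case: g / e hg => hg.
by congr OverHom; exact: Prop_irrelevance.
Qed.

Program Definition slice : cat :=
  @Cat over_ob over_hom (fun x => OverHom (idm (o_ob x)) _)
    (fun x y z g f => OverHom (over_fun g \c over_fun f) _) _ _ _.
Next Obligation. by move=> x /=; rewrite comp_idr. Qed.
Next Obligation. by move=> x y z g f /=; rewrite compA !(over_funP f, over_funP g). Qed.
Next Obligation. by move=> x y f; apply: over_eq; rewrite /= comp_idl. Qed.
Next Obligation. by move=> x y f; apply: over_eq; rewrite /= comp_idr. Qed.
Next Obligation. by move=> *; apply: over_eq; rewrite /= compA. Qed.

Lemma slice_compE (x y z : slice) (g : hom y z) (f : hom x y) :
  over_fun (g \c f) = over_fun g \c over_fun f.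
Proof. by []. Qed.
End Slice.
#[global] Arguments OverHom {C b x y} over_fun _.
#[global] Arguments over_fun {C b x y} _.

Record fibre_products (C : cat) := FibreProducts {
  fp : forall x y z : C, hom x z -> hom y z -> C;
  fp1 : forall x y z (f : hom x z) (g : hom y z), hom (fp f g) x;
  fp2 : forall x y z (f : hom x z) (g : hom y z), hom (fp f g) y;
  fp_pair : forall x y z (f : hom x z) (g : hom y z) w
    (a : hom w x) (b : hom w y), f \c a = g \c b -> hom w (fp f g);
  fp_sq : forall x y z (f : hom x z) (g : hom y z), f \c fp1 f g = g \c fp2 f g;
  fp_pair1 : forall x y z (f : hom x z) (g : hom y z) w
    (a : hom w x) (b : hom w y) (e : f \c a = g \c b), fp1 f g \c fp_pair e = a;
  fp_pair2 : forall x y z (f : hom x z) (g : hom y z) w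
    (a : hom w x) (b : hom w y) (e : f \c a = g \c b), fp2 f g \c fp_pair e = b;
  fp_ext : forall x y z (f : hom x z) (g : hom y z) w (c d : hom w (fp f g)),
    fp1 f g \c c = fp1 f g \c d -> fp2 f g \c c = fp2 f g \c d -> c = d
}.

Record finite_products (C : cat) := FiniteProducts {
  one_ob : C;
  bang : forall x, hom x one_ob;
  bang_uniq : forall x (f : hom x one_ob), f = bang x;
  prod_ob : C -> C -> C;
  pr1 : forall x y, hom (prod_ob x y) x;
  pr2 : forall x y, hom (prod_ob x y) y;
  pair_hom : forall w x y, hom w x -> hom w y -> hom w (prod_ob x y);
  pair_hom1 : forall w x y (a : hom w x) (b : hom w y),
    pr1 x y \c pair_hom a b = a;
  pair_hom2 : forall w x y (a : hom w x) (b : hom w y),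
    pr2 x y \c pair_hom a b = b;
  pair_ext : forall w x y (c d : hom w (prod_ob x y)),
    pr1 x y \c c = pr1 x y \c d -> pr2 x y \c c = pr2 x y \c d -> c = d
}.

Program Definition coslice_fibre_products (C : cat) (P : fibre_products C)
  (a : C) : fibre_products (coslice a) :=
  @FibreProducts (coslice a)
    (fun x y z f g =>
      @Under C a (fp P (under_fun f) (under_fun g))
        (fp_pair P (_ : under_fun f \c u_map x = under_fun g \c u_map y)))
    (fun x y z f g => UnderHom (fp1 P (under_fun f) (under_fun g)) _)
    (fun x y z f g => UnderHom (fp2 P (under_fun f) (under_fun g)) _)
    (fun x y z f g w c d e =>
      UnderHom (fp_pair P (_ : under_fun f \c under_fun c = under_fun g \c under_fun d)) _)
    _ _ _ _.
Next Obligation. by move=> C P a x y z f g; rewrite (under_funP f) (under_funP g). Qed.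
Next Obligation. by move=> C P a x y z f g; exact: fp_pair1. Qed.
Next Obligation. by move=> C P a x y z f g; exact: fp_pair2. Qed.
Next Obligation. by move=> C P a x y z f g w c d /(congr1 under_fun). Qed.
Next Obligation.
move=> C P a x y z f g w c d e; apply: (@fp_ext _ P); rewrite /= compA.
  by rewrite !fp_pair1 (under_funP c).
by rewrite !fp_pair2 (under_funP d).
Qed.
Next Obligation. by move=> C P a x y z f g; apply: under_eq; exact: fp_sq. Qed.
Next Obligation. by move=> *; apply: under_eq; exact: fp_pair1. Qed.
Next Obligation. by move=> *; apply: under_eq; exact: fp_pair2. Qed.
Next Obligation.
move=> C P a x y z f g w c d /(congr1 under_fun) e1 /(congr1 under_fun) e2.
by apply: under_eq; exact: fp_ext e1 e2.
Qed.

Program Definition slice_finite_products (C : cat) (P : fibre_products C)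
  (b : C) : finite_products (slice b) :=
  @FiniteProducts (slice b)
    (@Over C b b (idm b))
    (fun x => OverHom (o_map x) _) _
    (fun x y => @Over C b (fp P (o_map x) (o_map y))
                  (o_map x \c fp1 P (o_map x) (o_map y)))
    (fun x y => OverHom (fp1 P (o_map x) (o_map y)) _)
    (fun x y => OverHom (fp2 P (o_map x) (o_map y)) _)
    (fun w x y c d =>
      OverHom (fp_pair P (_ : o_map x \c over_fun c = o_map y \c over_fun d)) _)
    _ _ _.
Next Obligation. by move=> C P b x /=; rewrite comp_idl. Qed.
Next Obligation.
by move=> C P b x f; apply: over_eq; have := over_funP f; rewrite /= comp_idl.
Qed.
Next Obligation. by []. Qed.
Next Obligation. by move=> C P b x y /=; rewrite fp_sq. Qed.
Next Obligation. by move=> C P b w x y c d; rewrite (over_funP c) (over_funP d). Qed.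
Next Obligation.
by move=> C P b w x y c d /=; rewrite -compA fp_pair1 (over_funP c).
Qed.
Next Obligation. by move=> *; apply: over_eq; exact: fp_pair1. Qed.
Next Obligation. by move=> *; apply: over_eq; exact: fp_pair2. Qed.
Next Obligation.
move=> C P b w x y c d /(congr1 over_fun) e1 /(congr1 over_fun) e2.
by apply: over_eq; exact: fp_ext e1 e2.
Qed.

Section AbelianGroupObjects.
Variables (C : cat) (P : finite_products C).

Local Notation "<< a , b >>" := (pair_hom P a b) : cat_scope.
Local Notation "!" := (bang P _) (at level 0) : cat_scope.
Local Notation p1 := (pr1 P _ _).
Local Notation p2 := (pr2 P _ _).

Record ab_ob := AbOb {
  ab_car :> C;
  ab_add : hom (prod_ob P ab_car ab_car) ab_car;
  ab_zero : hom (one_ob P) ab_car;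
  ab_opp : hom ab_car ab_car;
  ab_addA : ab_add \c <<p1, ab_add \c p2>> =
    ab_add \c <<ab_add \c <<p1, p1 \c p2>>, p2 \c p2>>
    :> hom (prod_ob P ab_car (prod_ob P ab_car ab_car)) ab_car;
  ab_addC : ab_add \c <<p2, p1>> = ab_add;
  ab_add0 : ab_add \c <<idm ab_car, ab_zero \c !>> = idm ab_car;
  ab_addN : ab_add \c <<idm ab_car, ab_opp>> = ab_zero \c !
}.

Record ab_hom (x y : ab_ob) := AbHom {
  ab_fun : hom x y;
  ab_funP : ab_fun \c ab_add x = ab_add y \c <<ab_fun \c p1, ab_fun \c p2>>
}.
Arguments AbHom {x y} ab_fun _.

Lemma ab_hom_eq (x y : ab_ob) (f g : ab_hom x y) : ab_fun f = ab_fun g -> f = g.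
Proof.
case: f g => [f hf] [g hg] /= e; case: g / e hg => hg.
by congr AbHom; exact: Prop_irrelevance.
Qed.

Lemma pair_comp w z x y (c : hom z x) (d : hom z y) (h : hom w z) :
  <<c, d>> \c h = <<c \c h, d \c h>>.
Proof. by apply: (@pair_ext _ P); rewrite compA !(pair_hom1, pair_hom2). Qed.

Program Definition ab_cat : cat :=
  @Cat ab_ob ab_hom (fun x => AbHom (idm (ab_car x)) _)
    (fun x y z g f => AbHom (ab_fun g \c ab_fun f) _) _ _ _.
Next Obligation.
move=> x /=; rewrite comp_idl -[LHS]comp_idr; congr (_ \c _).
by apply: (@pair_ext _ P); rewrite !(pair_hom1, pair_hom2, comp_idl, comp_idr).
Qed.
Next Obligation.
move=> x y z g f /=; rewrite -compA (ab_funP f) compA (ab_funP g) -compA.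
by rewrite pair_comp -!compA pair_hom1 pair_hom2.
Qed.
Next Obligation. by move=> x y f; apply: ab_hom_eq; rewrite /= comp_idl. Qed.
Next Obligation. by move=> x y f; apply: ab_hom_eq; rewrite /= comp_idr. Qed.
Next Obligation. by move=> *; apply: ab_hom_eq; rewrite /= compA. Qed.

Lemma ab_compE (x y z : ab_cat) (g : hom y z) (f : hom x y) :
  ab_fun (g \c f) = ab_fun g \c ab_fun f.
Proof. by []. Qed.

Section GeneralizedElements.
Variables (x : ab_ob) (w : C).
Local Notation "a +' b" := (ab_add x \c <<a, b>>) (at level 50) : cat_scope.

Lemma gel_addA (a b c : hom w x) : a +' (b +' c) = (a +' b) +' c.
Proof.
have := congr1 (fun h => h \c <<a, <<b, c>>>>) (ab_addA x).
rewrite -!compA !pair_comp -!compA !(pair_hom1, pair_hom2).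
by rewrite !pair_comp -!compA !(pair_hom1, pair_hom2).
Qed.

Lemma gel_addr0 (a : hom w x) : a +' (ab_zero x \c !) = a.
Proof.
have := congr1 (fun h => h \c a) (ab_add0 x).
rewrite -compA pair_comp !comp_idl -compA.
by rewrite (bang_uniq (bang P _ \c a)).
Qed.

Lemma gel_addrN (a : hom w x) : a +' (ab_opp x \c a) = ab_zero x \c !.
Proof.
have := congr1 (fun h => h \c a) (ab_addN x).
rewrite -!compA pair_comp !comp_idl.
by rewrite (bang_uniq (bang P _ \c a)).
Qed.

Lemma gel_idem (a : hom w x) : a +' a = a -> a = ab_zero x \c !.
Proof.
by move=> e; rewrite -(gel_addrN a) -{2}e -gel_addA gel_addrN gel_addr0.
Qed.
End GeneralizedElements.

Lemma ab_hom_zero (x y : ab_ob) (f : ab_hom x y) : ab_fun f \c ab_zero x = ab_zero y.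
Proof.
have bang1 : bang P (one_ob P) = idm _ by rewrite [RHS]bang_uniq.
suff : ab_fun f \c ab_zero x = ab_zero y \c ! by rewrite bang1 comp_idr.
apply: gel_idem.
have e0 : ab_add x \c <<ab_zero x, ab_zero x>> = ab_zero x.
  by have := gel_addr0 (ab_zero x); rewrite bang1 comp_idr.
rewrite -[in RHS]e0 compA (ab_funP f) -compA pair_comp -!compA.
by rewrite pair_hom1 pair_hom2.
Qed.

End AbelianGroupObjects.
#[global] Arguments AbHom {C P x y} ab_fun _.
#[global] Arguments ab_fun {C P x y} _.
End Categories.

Local Open Scope ring_scope.

Record mackey (gT : finGroupType) := Mackey {
  mk_car :> gset gT -> zmodType;
  mk_res : forall X Y : gset gT, gmap X Y -> mk_car Y -> mk_car X;
  mk_tr : forall X Y : gset gT, gmap X Y -> mk_car X -> mk_car Y;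
  mk_resB : forall X Y (f : gmap X Y), zmod_morphism (mk_res f);
  mk_trB : forall X Y (f : gmap X Y), zmod_morphism (mk_tr f);
  mk_res_id : forall X x, mk_res (hid X) x = x;
  mk_tr_id : forall X x, mk_tr (hid X) x = x;
  mk_res_comp : forall X Y Z (g : gmap Y Z) (f : gmap X Y) x,
    mk_res (hcomp g f) x = mk_res f (mk_res g x);
  mk_tr_comp : forall X Y Z (g : gmap Y Z) (f : gmap X Y) x,
    mk_tr (hcomp g f) x = mk_tr g (mk_tr f x);
  mk_void : forall x : mk_car (htriv [set: gT]%G void), x = 0;
  mk_sum : forall (X Y : gset gT) (x : mk_car X) (y : mk_car Y),
    exists! z : mk_car (hsum X Y),
      mk_res (hinl X Y) z = x /\ mk_res (hinr X Y) z = y;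
  mk_dc : forall (X Y Z W : gset gT) (f : gmap X Z) (g : gmap Y Z)
      (f' : gmap W Y) (g' : gmap W X), is_pullback f g f' g' ->
    forall x, mk_res g (mk_tr f x) = mk_tr f' (mk_res g' x)
}.
Arguments mk_res {gT} M {X Y} f x : rename.
Arguments mk_tr {gT} M {X Y} f x : rename.

HB.instance Definition _ (gT : finGroupType) (M : mackey gT) (X Y : gset gT)
  (f : gmap X Y) :=
  GRing.isZmodMorphism.Build (M Y) (M X) (mk_res M f) (@mk_resB gT M X Y f).
HB.instance Definition _ (gT : finGroupType) (M : mackey gT) (X Y : gset gT)
  (f : gmap X Y) :=
  GRing.isZmodMorphism.Build (M X) (M Y) (mk_tr M f) (@mk_trB gT M X Y f).

Record mkmap (gT : finGroupType) (M N : mackey gT) := MkMap {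
  mkm_fun :> forall X : gset gT, M X -> N X;
  mkm_B : forall X, zmod_morphism (@mkm_fun X);
  mkm_res : forall X Y (f : gmap X Y) x,
    mkm_fun (mk_res M f x) = mk_res N f (mkm_fun x);
  mkm_tr : forall X Y (f : gmap X Y) x,
    mkm_fun (mk_tr M f x) = mk_tr N f (mkm_fun x)
}.
Arguments mkm_fun {gT M N} _ {X} _.

HB.instance Definition _ (gT : finGroupType) (M N : mackey gT)
  (u : mkmap M N) (X : gset gT) :=
  GRing.isZmodMorphism.Build (M X) (N X) (@mkm_fun gT M N u X) (@mkm_B gT M N u X).

Lemma mkm_eq (gT : finGroupType) (M N : mackey gT) (u v : mkmap M N) :
  (forall X (x : M X), u X x = v X x) -> u = v.
Proof.
case: u v => [u u1 u2 u3] [v v1 v2 v3] /= e.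
have {}e : u = v by apply: functional_extensionality_dep => X; exact: funext (e X).
case: v / e v1 v2 v3 => v1 v2 v3.
by congr MkMap; exact: Prop_irrelevance.
Qed.

Program Definition mkmap_id (gT : finGroupType) (M : mackey gT) : mkmap M M :=
  @MkMap gT M M (fun _ x => x) _ _ _.
Solve All Obligations with by [].

Program Definition mkmap_comp (gT : finGroupType) (M N P : mackey gT)
  (v : mkmap N P) (u : mkmap M N) : mkmap M P :=
  @MkMap gT M P (fun _ x => v _ (u _ x)) _ _ _.
Next Obligation. by move=> gT M N P v u X x y; rewrite !raddfB. Qed.
Next Obligation. by move=> * /=; rewrite !mkm_res. Qed.
Next Obligation. by move=> * /=; rewrite !mkm_tr. Qed.

Section DirectSum.
Variables (gT : finGroupType) (M N : mackey gT).

Program Definition mk_dsum : mackey gT :=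
  @Mackey gT (fun X => (M X * N X)%type : zmodType)
    (fun X Y f u => (mk_res M f u.1, mk_res N f u.2))
    (fun X Y f u => (mk_tr M f u.1, mk_tr N f u.2)) _ _ _ _ _ _ _ _ _.
Next Obligation. by move=> X Y f u v; rewrite !raddfB. Qed.
Next Obligation. by move=> X Y f u v; rewrite !raddfB. Qed.
Next Obligation. by move=> X [x y]; rewrite !mk_res_id. Qed.
Next Obligation. by move=> X [x y]; rewrite !mk_tr_id. Qed.
Next Obligation. by move=> X Y Z g f [x y]; rewrite !mk_res_comp. Qed.
Next Obligation. by move=> X Y Z g f [x y]; rewrite !mk_tr_comp. Qed.
Next Obligation. by move=> [x y]; rewrite (mk_void x) (mk_void y). Qed.
Next Obligation.
move=> X Y [x1 x2] [y1 y2].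
have [z1 [[<- <-] u1]] := mk_sum x1 y1; have [z2 [[<- <-] u2]] := mk_sum x2 y2.
exists (z1, z2); split=> // -[t1 t2] /= [[e1 e2] [e3 e4]].
by rewrite (u1 t1) // (u2 t2).
Qed.
Next Obligation. by move=> X Y Z W f g f' g' pb [x y]; rewrite /= !(mk_dc pb). Qed.
End DirectSum.

Section KernelGroup.
Variables (V W : zmodType) (f : {additive V -> W}).

Definition kerp : {pred V} := fun x => f x == 0.

Lemma kerp_zmod_closed : zmod_closed kerp.
Proof.
split=> [|x y]; rewrite /kerp !unfold_in ?raddf0 //.
by move=> /eqP ex /eqP ey; rewrite raddfB ex ey subrr.
Qed.
HB.instance Definition _ := GRing.isZmodClosed.Build V kerp kerp_zmod_closed.

Record kerz := Kerz { kerz_val : V; kerzP : kerz_val \in kerp }.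
HB.instance Definition _ := [isSub for kerz_val].
HB.instance Definition _ := [Choice of kerz by <:].
HB.instance Definition _ := [SubChoice_isSubZmodule of kerz by <:].

Lemma kerz0 (x : kerz) : f (kerz_val x) = 0.
Proof. exact/eqP/(kerzP x). Qed.

Lemma kerzE (x : V) : f x = 0 -> x \in kerp.
Proof. by move=> e; apply/eqP. Qed.
End KernelGroup.

Section Kernel.
Variables (gT : finGroupType) (M N : mackey gT) (u : mkmap M N).

Let ker X := kerz (@mkm_fun gT M N u X).

Lemma ker_res_subproof X Y (f : gmap X Y) (x : ker Y) :
  mk_res M f (val x) \in kerp (@mkm_fun gT M N u X).
Proof. by apply: kerzE; rewrite /= mkm_res kerz0 raddf0. Qed.

Lemma ker_tr_subproof X Y (f : gmap X Y) (x : ker X) :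
  mk_tr M f (val x) \in kerp (@mkm_fun gT M N u Y).
Proof. by apply: kerzE; rewrite /= mkm_tr kerz0 raddf0. Qed.

Program Definition mk_ker : mackey gT :=
  @Mackey gT (fun X => ker X : zmodType)
    (fun X Y f x => Kerz (ker_res_subproof f x))
    (fun X Y f x => Kerz (ker_tr_subproof f x)) _ _ _ _ _ _ _ _ _.
Next Obligation. by move=> X Y f x y; apply: val_inj; rewrite /= !raddfB. Qed.
Next Obligation. by move=> X Y f x y; apply: val_inj; rewrite /= !raddfB. Qed.
Next Obligation. by move=> X x; apply: val_inj; exact: mk_res_id. Qed.
Next Obligation. by move=> X x; apply: val_inj; exact: mk_tr_id. Qed.
Next Obligation. by move=> X Y Z g f x; apply: val_inj; exact: mk_res_comp. Qed.
Next Obligation. by move=> X Y Z g f x; apply: val_inj; exact: mk_tr_comp. Qed.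
Next Obligation. by move=> x; apply: val_inj; exact: mk_void. Qed.
Next Obligation.
move=> X Y x y; have [z [[ex ey] uz]] := mk_sum (val x) (val y).
have hz : u _ z = 0.
  have [t [_ ut]] := mk_sum (0 : N X) (0 : N Y).
  rewrite -(ut (u _ z)); last by rewrite -!mkm_res ex ey !kerz0.
  by rewrite -(ut 0) // !raddf0.
exists (Kerz (kerzE hz)); split; first by split; apply: val_inj.
move=> t [/(congr1 val) /= e1 /(congr1 val) /= e2].
by apply: val_inj; apply: uz.
Qed.
Next Obligation.
by move=> X Y Z W f g f' g' pb x; apply: val_inj; exact: (mk_dc pb).
Qed.
End Kernel.

(* A map out of the box product M [] N -> P, in terms of its universal property:
   a Dress pairing of (M, N) into P. *)
Record dress_pairing (gT : finGroupType) (M N P : mackey gT)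
    (p : forall X, M X -> N X -> P X) : Prop := DressPairing {
  dpBl : forall X y, zmod_morphism (fun x => p X x y);
  dpBr : forall X x, zmod_morphism (fun y => p X x y);
  dp_res : forall X Y (f : gmap X Y) x y,
    mk_res P f (p Y x y) = p X (mk_res M f x) (mk_res N f y);
  dp_frobl : forall X Y (f : gmap X Y) x y,
    p Y (mk_tr M f x) y = mk_tr P f (p X x (mk_res N f y));
  dp_frobr : forall X Y (f : gmap X Y) x y,
    p Y x (mk_tr N f y) = mk_tr P f (p X (mk_res M f x) y)
}.

Section DressPairingTheory.
Variables (gT : finGroupType) (M N P : mackey gT).
Variables (p : forall X, M X -> N X -> P X) (dp : dress_pairing p).

Let pl X y : {additive M X -> P X} :=
  HB.pack (fun x => p x y) (GRing.isZmodMorphism.Build _ _ _ (@dpBl _ _ _ _ _ dp X y)).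
Let pr X x : {additive N X -> P X} :=
  HB.pack (fun y => p x y) (GRing.isZmodMorphism.Build _ _ _ (@dpBr _ _ _ _ _ dp X x)).

Lemma dp_0l X (y : N X) : p 0 y = 0. Proof. exact: (raddf0 (pl y)). Qed.
Lemma dp_0r X (x : M X) : p x 0 = 0. Proof. exact: (raddf0 (pr x)). Qed.
Lemma dp_Nr X (x : M X) (y : N X) : p x (- y) = - p x y.
Proof. exact: (raddfN (pr x)). Qed.
Lemma dp_Dl X (x x' : M X) y : p (x + x') y = p x y + p x' y.
Proof. exact: (raddfD (pl y)). Qed.
Lemma dp_Dr X (x : M X) (y y' : N X) : p x (y + y') = p x y + p x y'.
Proof. exact: (raddfD (pr x)). Qed.
End DressPairingTheory.

(* Commutative monoids for the box product.  A map from the unit (the Burnside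
   Mackey functor) into R is a family of elements 1 compatible with restriction. *)
Record green (gT : finGroupType) := Green {
  gr_mk :> mackey gT;
  gr_mul : forall X, gr_mk X -> gr_mk X -> gr_mk X;
  gr_one : forall X, gr_mk X;
  gr_dp : dress_pairing gr_mul;
  gr_res1 : forall X Y (f : gmap X Y), mk_res gr_mk f (gr_one Y) = gr_one X;
  gr_mulA : forall X (x y z : gr_mk X),
    gr_mul x (gr_mul y z) = gr_mul (gr_mul x y) z;
  gr_mulC : forall X (x y : gr_mk X), gr_mul x y = gr_mul y x;
  gr_mul1 : forall X (x : gr_mk X), gr_mul (gr_one X) x = x
}.
Arguments gr_mul {gT R X} x y : rename.
Arguments gr_one {gT} R X : rename.

Record gmod (gT : finGroupType) (B : green gT) := GMod {
  gm_mk :> mackey gT;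
  gm_act : forall X, B X -> gm_mk X -> gm_mk X;
  gm_dp : dress_pairing gm_act;
  gm_actA : forall X (b c : B X) (m : gm_mk X),
    gm_act b (gm_act c m) = gm_act (gr_mul b c) m;
  gm_act1 : forall X (m : gm_mk X), gm_act (gr_one B X) m = m
}.
Arguments gm_act {gT B M X} b m : rename.

Record gmod_hom (gT : finGroupType) (B : green gT) (M N : gmod B) := GModHom {
  gmh_mk :> mkmap M N;
  gmh_act : forall X (b : B X) (m : M X),
    gmh_mk X (gm_act b m) = gm_act b (gmh_mk X m)
}.
Arguments GModHom {gT B M N} gmh_mk _.

Section ModuleCategory.
Variables (gT : finGroupType) (B : green gT).

Lemma gmod_hom_eq (M N : gmod B) (u v : gmod_hom M N) :
  (forall X (x : M X), u X x = v X x) -> u = v.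
Proof.
case: u v => [u hu] [v hv] /= /mkm_eq e; case: v / e hv => hv.
by congr GModHom; exact: Prop_irrelevance.
Qed.

Program Definition gmod_cat : cat :=
  @Cat (gmod B) (@gmod_hom gT B) (fun M => GModHom (mkmap_id M) _)
    (fun M N P v u => GModHom (mkmap_comp v u) _) _ _ _.
Next Obligation. by []. Qed.
Next Obligation. by move=> M N P v u X b m /=; rewrite !gmh_act. Qed.
Next Obligation. by move=> *; exact: gmod_hom_eq. Qed.
Next Obligation. by move=> *; exact: gmod_hom_eq. Qed.
Next Obligation. by move=> *; exact: gmod_hom_eq. Qed.

Lemma gmod_compE (M N P : gmod_cat) (v : hom N P) (u : hom M N) :
  gmh_mk (comp v u) = mkmap_comp v u.
Proof. by []. Qed.
End ModuleCategory.

Section Tambara.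
Variables (gT : finGroupType) (O : indexing_system gT).

Definition norms (R : mackey gT) :=
  forall X Y (f : gmap X Y), admissible O f -> R X -> R Y.

(* The maps produced from f by pullback or composition are again admissible, so
   that quantifying over the proofs of admissibility below loses nothing. *)
Record tambara_axioms (R : green gT) (N : norms R) : Prop := TambaraAxioms {
  norm_id : forall X (a : admissible O (hid X)) x, N _ _ _ a x = x;
  norm_comp : forall X Y Z (g : gmap Y Z) (f : gmap X Y) (ag : admissible O g)
      (af : admissible O f) (agf : admissible O (hcomp g f)) x,
    N _ _ _ agf x = N _ _ _ ag (N _ _ _ af x);
  norm1 : forall X Y (f : gmap X Y) (a : admissible O f),
    N _ _ _ a (gr_one R X) = gr_one R Y;
  normM : forall X Y (f : gmap X Y) (a : admissible O f) x y,
    N _ _ _ a (gr_mul x y) = gr_mul (N _ _ _ a x) (N _ _ _ a y);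
  norm_fold : forall X (a : admissible O (hfold X)) x,
    N _ _ _ a x = gr_mul (mk_res R (hinl X X) x) (mk_res R (hinr X X) x);
  norm_dc : forall (X Y Z W : gset gT) (f : gmap X Z) (g : gmap Y Z)
      (f' : gmap W Y) (g' : gmap W X), is_pullback f g f' g' ->
    forall (a : admissible O f) (a' : admissible O f') x,
      mk_res R g (N _ _ _ a x) = N _ _ _ a' (mk_res R g' x);
  norm_tr : forall (S X Y Z P : gset gT) (h : gmap S X) (f : gmap X Y)
      (q : gmap Z Y) (p : gmap P Z) (k : gmap P X) (e : gmap P S),
    is_exponential h f q p k e ->
    forall (af : admissible O f) (ap : admissible O p) x,
      N _ _ _ af (mk_tr R h x) = mk_tr R q (N _ _ _ ap (mk_res R e x))
}.

Record tambara := Tambara {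
  tb_gr :> green gT;
  tb_norm : norms tb_gr;
  tb_ax : tambara_axioms tb_norm
}.
Arguments tb_norm R {X Y f} a x : rename.

Record tbmap (R S : tambara) := TbMap {
  tbm_mk :> mkmap R S;
  tbm_1 : forall X, tbm_mk X (gr_one R X) = gr_one S X;
  tbm_M : forall X (x y : R X), tbm_mk X (gr_mul x y) = gr_mul (tbm_mk X x) (tbm_mk X y);
  tbm_N : forall X Y (f : gmap X Y) (a : admissible O f) x,
    tbm_mk Y (tb_norm R a x) = tb_norm S a (tbm_mk X x)
}.

Lemma tbm_eq (R S : tambara) (u v : tbmap R S) :
  (forall X (x : R X), u X x = v X x) -> u = v.
Proof.
case: u v => [u u1 u2 u3] [v v1 v2 v3] /= /mkm_eq e.
by case: v / e v1 v2 v3 => v1 v2 v3; congr TbMap; exact: Prop_irrelevance.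
Qed.

Lemma tbm_app (R S : tambara) (u v : tbmap R S) : u = v ->
  forall X (x : R X), u X x = v X x.
Proof. by move->. Qed.

Program Definition tbmap_id (R : tambara) : tbmap R R :=
  @TbMap R R (mkmap_id R) _ _ _.
Solve All Obligations with by [].

Program Definition tbmap_comp (R S T : tambara) (v : tbmap S T) (u : tbmap R S) :
  tbmap R T := @TbMap R T (mkmap_comp v u) _ _ _.
Next Obligation. by move=> *; rewrite /= !tbm_1. Qed.
Next Obligation. by move=> *; rewrite /= !tbm_M. Qed.
Next Obligation. by move=> *; rewrite /= !tbm_N. Qed.

Program Definition tambara_cat : cat :=
  @Cat tambara tbmap tbmap_id tbmap_comp _ _ _.
Next Obligation. by move=> *; exact: tbm_eq. Qed.
Next Obligation. by move=> *; exact: tbm_eq. Qed.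
Next Obligation. by move=> *; exact: tbm_eq. Qed.

Section FibreProduct.
Variables (R S T : tambara) (u : tbmap R T) (v : tbmap S T).

Program Definition fp_diff : mkmap (mk_dsum R S) T :=
  @MkMap gT (mk_dsum R S) T (fun X x => u X x.1 - v X x.2) _ _ _.
Next Obligation. by move=> X x y /=; rewrite !mkm_B !opprB -!addrA; congr (_ + _); rewrite addrCA [RHS]addrCA; congr (_ + _); exact: addrC. Qed.
Next Obligation. by move=> X Y f x; rewrite /= !mkm_res raddfB. Qed.
Next Obligation. by move=> X Y f x; rewrite /= !mkm_tr raddfB. Qed.

Let P := mk_ker fp_diff.

Lemma fpP X (x : P X) : u X (val x).1 = v X (val x).2.
Proof. by apply/eqP; rewrite -subr_eq0; apply/eqP; exact: (kerz0 x). Qed.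

Definition fp_el X (x : R X) (y : S X) (e : u X x = v X y) : P X.
Proof. by exists (x, y); apply: kerzE; rewrite /= e subrr. Defined.

Lemma fp_eq X (x y : P X) :
  (val x).1 = (val y).1 -> (val x).2 = (val y).2 -> x = y.
Proof.
move=> e1 e2; apply: val_inj; rewrite [LHS]surjective_pairing.
by rewrite [RHS]surjective_pairing e1 e2.
Qed.

Lemma fp_mul_subproof X (x y : P X) :
  u X (gr_mul (val x).1 (val y).1) = v X (gr_mul (val x).2 (val y).2).
Proof. by rewrite !tbm_M !fpP. Qed.

Lemma fp_one_subproof X : u X (gr_one R X) = v X (gr_one S X).
Proof. by rewrite !tbm_1. Qed.

Lemma fp_norm_subproof X Y (f : gmap X Y) (a : admissible O f) (x : P X) :
  u Y (tb_norm R a (val x).1) = v Y (tb_norm S a (val x).2).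
Proof. by rewrite !tbm_N fpP. Qed.

Program Definition fp_green : green gT :=
  @Green gT P (fun X x y => fp_el (fp_mul_subproof x y))
    (fun X => fp_el (fp_one_subproof X)) _ _ _ _ _.
Next Obligation.
split=> [X y x x'|X x y y'|X Y f x y|X Y f x y|X Y f x y]; apply: fp_eq => /=.
- exact: (dpBl (gr_dp R)).
- exact: (dpBl (gr_dp S)).
- exact: (dpBr (gr_dp R)).
- exact: (dpBr (gr_dp S)).
- exact: (dp_res (gr_dp R)).
- exact: (dp_res (gr_dp S)).
- exact: (dp_frobl (gr_dp R)).
- exact: (dp_frobl (gr_dp S)).
- exact: (dp_frobr (gr_dp R)).
- exact: (dp_frobr (gr_dp S)).
Qed.
Next Obligation. by move=> X Y f; apply: fp_eq; exact: gr_res1. Qed.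
Next Obligation. by move=> X x y z; apply: fp_eq; exact: gr_mulA. Qed.
Next Obligation. by move=> X x y; apply: fp_eq; exact: gr_mulC. Qed.
Next Obligation. by move=> X x; apply: fp_eq; exact: gr_mul1. Qed.

Program Definition fp_tambara : tambara :=
  @Tambara fp_green (fun X Y f a x => fp_el (fp_norm_subproof a x)) _.
Next Obligation.
split=> [|||||X Y Z W f g f' g' pb|S' X Y Z Q h f q p k e ex] *; apply: fp_eq => /=.
- exact: (norm_id (tb_ax R)).
- exact: (norm_id (tb_ax S)).
- exact: (norm_comp (tb_ax R)).
- exact: (norm_comp (tb_ax S)).
- exact: (norm1 (tb_ax R)).
- exact: (norm1 (tb_ax S)).
- exact: (normM (tb_ax R)).
- exact: (normM (tb_ax S)).
- exact: (norm_fold (tb_ax R)).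
- exact: (norm_fold (tb_ax S)).
- exact: (norm_dc (tb_ax R) pb).
- exact: (norm_dc (tb_ax S) pb).
- exact: (norm_tr (tb_ax R) ex).
- exact: (norm_tr (tb_ax S) ex).
Qed.

Program Definition fp_proj1 : tbmap fp_tambara R :=
  @TbMap fp_tambara R (@MkMap gT P R (fun X x => (val x).1) _ _ _) _ _ _.
Solve All Obligations with by [].

Program Definition fp_proj2 : tbmap fp_tambara S :=
  @TbMap fp_tambara S (@MkMap gT P S (fun X x => (val x).2) _ _ _) _ _ _.
Solve All Obligations with by [].

Program Definition fp_univ (Q : tambara) (c : tbmap Q R) (d : tbmap Q S)
  (e : tbmap_comp u c = tbmap_comp v d) : tbmap Q fp_tambara :=
  @TbMap Q fp_tambara (@MkMap gT Q P
     (fun X x => fp_el (tbm_app e x : u X (c X x) = v X (d X x))) _ _ _) _ _ _.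
Next Obligation. by move=> Q c d e X x y; apply: fp_eq; rewrite /= raddfB. Qed.
Next Obligation. by move=> Q c d e X Y f x; apply: fp_eq; exact: mkm_res. Qed.
Next Obligation. by move=> Q c d e X Y f x; apply: fp_eq; exact: mkm_tr. Qed.
Next Obligation. by move=> Q c d e X; apply: fp_eq; exact: tbm_1. Qed.
Next Obligation. by move=> Q c d e X x y; apply: fp_eq; exact: tbm_M. Qed.
Next Obligation. by move=> Q c d e X Y f a x; apply: fp_eq; exact: tbm_N. Qed.
End FibreProduct.

Program Definition tambara_fibre_products : fibre_products tambara_cat :=
  @FibreProducts tambara_cat fp_tambara fp_proj1 fp_proj2
    (fun R S T u v Q c d e => fp_univ e) _ _ _ _.
Next Obligation. by move=> R S T u v; apply: tbm_eq => X x; exact: fpP. Qed.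
Next Obligation. by move=> *; exact: tbm_eq. Qed.
Next Obligation. by move=> *; exact: tbm_eq. Qed.
Next Obligation.
move=> R S T u v Q c d e1 e2; apply: tbm_eq => X x.
by apply: fp_eq; [exact: (tbm_app e1)|exact: (tbm_app e2)].
Qed.

End Tambara.
Arguments tb_norm {gT O} R {X Y f} a x : rename.

Definition calg (gT : finGroupType) (O : indexing_system gT) (A : tambara O) :
  cat := @coslice (tambara_cat O) A.

Definition calg_over (gT : finGroupType) (O : indexing_system gT)
  (A : tambara O) (B : calg A) : cat := slice B.

Definition calg_over_products (gT : finGroupType) (O : indexing_system gT)
    (A : tambara O) (B : calg A) : finite_products (calg_over B) :=
  slice_finite_products
    (coslice_fibre_products (tambara_fibre_products O) A) B.

Definition calg_ab (gT : finGroupType) (O : indexing_system gT)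
  (A : tambara O) (B : calg A) : cat := ab_cat (calg_over_products B).

Section Main.
Variables (gT : finGroupType) (O : indexing_system gT) (A : tambara O).
Variable (B : calg A).

Let Bt : tambara O := u_ob B.

Definition over_tambara (R : calg_over B) : tambara O := u_ob (o_ob R).

Definition over_aug (R : calg_over B) : tbmap (over_tambara R) Bt :=
  under_fun (o_map R).

Definition over_tbmap (R S : calg_over B) (u : hom R S) :
  tbmap (over_tambara R) (over_tambara S) := under_fun (over_fun u).

Section OverTheory.
Local Notation P := (calg_over_products B).
Implicit Types R S T : calg_over B.

Lemma over_tbmap_inj R S (u v : hom R S) :
  (forall X x, over_tbmap u X x = over_tbmap v X x) -> u = v.
Proof. by move=> e; apply: over_eq; apply: under_eq; exact: tbm_eq e. Qed.

Lemma over_tbmap_comp R S T (v : hom S T) (u : hom R S) X x :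
  over_tbmap (comp v u) X x = over_tbmap v X (over_tbmap u X x).
Proof. by rewrite /over_tbmap slice_compE coslice_compE. Qed.

Lemma over_tbmap_id R X x : over_tbmap (idm R) X x = x.
Proof. by []. Qed.

Lemma over_tbmap_aug R S (u : hom R S) X x :
  over_aug S X (over_tbmap u X x) = over_aug R X x.
Proof.
have e : tbmap_comp (over_aug S) (over_tbmap u) = over_aug R.
  exact: (congr1 under_fun (over_funP u)).
by rewrite -e.
Qed.

Lemma over_tbmap_bang R X x : over_tbmap (bang P R) X x = over_aug R X x.
Proof. by []. Qed.

Definition over_prod_val R S X (x : over_tambara (prod_ob P R S) X) :
  over_tambara R X * over_tambara S X := kerz_val x.

Lemma over_tbmap_pr1 R S X x :
  over_tbmap (pr1 P R S) X x = (over_prod_val x).1.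
Proof. by []. Qed.

Lemma over_tbmap_pr2 R S X x :
  over_tbmap (pr2 P R S) X x = (over_prod_val x).2.
Proof. by []. Qed.

Lemma over_prod_pair T R S (u : hom T R) (v : hom T S) X x :
  over_prod_val (over_tbmap (pair_hom P u v) X x) =
  (over_tbmap u X x, over_tbmap v X x).
Proof. by []. Qed.

Lemma over_prodP R S X (x : over_tambara (prod_ob P R S) X) :
  over_aug R X (over_prod_val x).1 = over_aug S X (over_prod_val x).2.
Proof. exact: (fpP (u := over_aug R) (v := over_aug S) x). Qed.

Definition over_tbmapE := (over_tbmap_comp, over_tbmap_id, over_tbmap_bang,
  over_tbmap_pr1, over_tbmap_pr2, over_prod_pair).
End OverTheory.

Definition total (R : calg_ab B) : tambara O := over_tambara (ab_car R).

Definition augmentation (R : calg_ab B) : tbmap (total R) Bt :=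
  over_aug (ab_car R).

(* The zero section B -> R: the terminal object of algebras over B is B. *)
Definition zero_section (R : calg_ab B) : tbmap Bt (total R) :=
  over_tbmap (ab_zero R).

Lemma zero_sectionK (R : calg_ab B) X (b : Bt X) :
  augmentation R X (zero_section R X b) = b.
Proof. exact: (over_tbmap_aug (ab_zero R)). Qed.

Definition kernel_norms_vanish (R : calg_ab B) : Prop :=
  forall (X Y : gset gT) (f : gmap X Y) (a : admissible O f),
    two_surjective f ->
    forall x : total R X, augmentation R X x = 0 -> tb_norm (total R) a x = 0.

Definition calg_ab_vanishing : cat := full_subcat kernel_norms_vanish.

Section AugmentationIdeal.
Variable R : calg_ab B.

Lemma aug_act_subproof X (b : Bt X) (x : mk_ker (augmentation R) X) :
  gr_mul (zero_section R X b) (val x) \in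
    kerp (@mkm_fun gT _ _ (augmentation R) X).
Proof.
by apply: kerzE; rewrite /= tbm_M (kerz0 x); exact: (dp_0r (gr_dp Bt)).
Qed.

Program Definition aug_ideal : gmod Bt :=
  @GMod gT Bt (mk_ker (augmentation R))
    (fun X b x => Kerz (aug_act_subproof b x)) _ _ _.
Next Obligation.
split=> [X y x x'|X x y y'|X Y f x y|X Y f x y|X Y f x y]; apply: val_inj => /=.
- by rewrite mkm_B; exact: (dpBl (gr_dp (total R))).
- exact: (dpBr (gr_dp (total R))).
- by rewrite mkm_res; exact: (dp_res (gr_dp (total R))).
- by rewrite mkm_tr; exact: (dp_frobl (gr_dp (total R))).
- by rewrite mkm_res; exact: (dp_frobr (gr_dp (total R))).
Qed.
Next Obligation.
by move=> X b c x; apply: val_inj; rewrite /= tbm_M gr_mulA.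
Qed.
Next Obligation. by move=> X x; apply: val_inj; rewrite /= tbm_1 gr_mul1. Qed.

Lemma aug_ideal_eq X (x y : aug_ideal X) : kerz_val x = kerz_val y -> x = y.
Proof. exact: val_inj. Qed.
End AugmentationIdeal.

Section AugmentationIdealMap.
Variables (R S : calg_ab B) (u : hom R S).

Definition total_map : tbmap (total R) (total S) := over_tbmap (ab_fun u).

Lemma total_map_aug X (x : total R X) :
  augmentation S X (total_map X x) = augmentation R X x.
Proof. exact: over_tbmap_aug. Qed.

Lemma total_map_zero X (b : Bt X) :
  total_map X (zero_section R X b) = zero_section S X b.
Proof.
by have := over_tbmap_comp (ab_fun u) (ab_zero R) b; rewrite ab_hom_zero.
Qed.

Lemma aug_map_subproof X (x : aug_ideal R X) :
  total_map X (val x) \in kerp (@mkm_fun gT _ _ (augmentation S) X).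
Proof. by apply: kerzE; rewrite /= total_map_aug; exact: (kerz0 x). Qed.

Program Definition aug_ideal_map : gmod_hom (aug_ideal R) (aug_ideal S) :=
  GModHom (@MkMap gT (aug_ideal R) (aug_ideal S)
    (fun X x => Kerz (aug_map_subproof x)) _ _ _) _.
Next Obligation. by move=> X x y; apply: val_inj; exact: mkm_B. Qed.
Next Obligation. by move=> X Y f x; apply: val_inj; exact: mkm_res. Qed.
Next Obligation. by move=> X Y f x; apply: val_inj; exact: mkm_tr. Qed.
Next Obligation.
by move=> X b m; apply: val_inj; rewrite /= tbm_M total_map_zero.
Qed.

Lemma aug_ideal_mapE X (x : aug_ideal R X) :
  kerz_val (aug_ideal_map X x) = total_map X (kerz_val x).
Proof. by []. Qed.
End AugmentationIdealMap.

Lemma total_map_comp (R S T : calg_ab B) (v : hom S T) (u : hom R S) X x :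
  total_map (comp v u) X x = total_map v X (total_map u X x).
Proof. by rewrite /total_map ab_compE over_tbmap_comp. Qed.

Program Definition aug_ideal_functor : functor calg_ab_vanishing (gmod_cat Bt) :=
  @Functor calg_ab_vanishing (gmod_cat Bt) (fun R => aug_ideal (sval R))
    (fun R S u => aug_ideal_map u) _ _.
Next Obligation. by move=> R; apply: gmod_hom_eq => X x; exact: val_inj. Qed.
Next Obligation.
move=> R S T v u; apply: gmod_hom_eq => X x; apply: aug_ideal_eq.
by rewrite gmod_compE !aug_ideal_mapE total_map_comp.
Qed.

Section SquareZero.
Variable M : gmod Bt.

Program Definition sqz_green : green gT :=
  @Green gT (mk_dsum Bt M)
    (fun X x y => (gr_mul x.1 y.1, gm_act x.1 y.2 + gm_act y.1 x.2))
    (fun X => (gr_one Bt X, 0)) _ _ _ _ _.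
Next Obligation.
have [g m] := (gr_dp Bt, gm_dp M).
split=> [X y x x'|X x y y'|X Y f x y|X Y f x y|X Y f x y]; congr pair => /=.
- exact: (dpBl g).
- by rewrite (dpBl m) (dpBr m) opprD addrACA.
- exact: (dpBr g).
- by rewrite (dpBl m) (dpBr m) opprD addrACA.
- exact: (dp_res g).
- by rewrite raddfD /= !(dp_res m).
- exact: (dp_frobl g).
- by rewrite (dp_frobl m) (dp_frobr m) -raddfD.
- exact: (dp_frobr g).
- by rewrite (dp_frobl m) (dp_frobr m) -raddfD.
Qed.
Next Obligation. by move=> X Y f; rewrite /= gr_res1 raddf0. Qed.
Next Obligation.
move=> X x y z /=; rewrite gr_mulA; congr pair.
rewrite !(dp_Dr (gm_dp M)) !gm_actA addrA.
by rewrite (gr_mulC z.1) (gr_mulC z.1).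
Qed.
Next Obligation. by move=> X x y /=; rewrite gr_mulC addrC. Qed.
Next Obligation.
by move=> X [x m] /=; rewrite gr_mul1 gm_act1 (dp_0r (gm_dp M)) addr0.
Qed.

Definition sqz_norm : norms O sqz_green := fun X Y f a x =>
  (tb_norm Bt a x.1,
   mk_tr M f (gm_act (tb_norm Bt (offdiag1_admissible a)
                        (mk_res Bt (offdiag2 f) x.1)) x.2)).

Hypothesis ax : tambara_axioms sqz_norm.

Definition sqz : tambara O := Tambara ax.

Program Definition sqz_proj : tbmap sqz Bt :=
  @TbMap gT O sqz Bt (@MkMap gT sqz Bt (fun X x => x.1) _ _ _) _ _ _.
Solve All Obligations with by [].

Program Definition sqz_incl : tbmap Bt sqz :=
  @TbMap gT O Bt sqz (@MkMap gT Bt sqz (fun X b => (b, 0)) _ _ _) _ _ _.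
Next Obligation. by move=> X x y; congr pair; rewrite subrr. Qed.
Next Obligation. by move=> X Y f x; rewrite /= raddf0. Qed.
Next Obligation. by move=> X Y f x; rewrite /= raddf0. Qed.
Next Obligation. by []. Qed.
Next Obligation.
by move=> X x y; rewrite /= !(dp_0r (gm_dp M)) addr0.
Qed.
Next Obligation.
by move=> X Y f a x; congr pair; rewrite /= (dp_0r (gm_dp M)) raddf0.
Qed.

Definition sqz_calg : calg A :=
  @Under (tambara_cat O) A sqz (comp (c := tambara_cat O) sqz_incl (u_map B)).

Program Definition sqz_over : calg_over B :=
  @Over (calg A) B sqz_calg (UnderHom sqz_proj _).
Next Obligation. by apply: tbm_eq. Qed.

Let sqz2 : tambara O := fp_tambara sqz_proj sqz_proj.

Program Definition sqz_add_map : tbmap sqz2 sqz :=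
  @TbMap gT O sqz2 sqz (@MkMap gT sqz2 sqz
    (fun X x => ((val x).1.1, (val x).1.2 + (val x).2.2)) _ _ _) _ _ _.
Next Obligation. by move=> X x y; congr pair; rewrite /= opprD addrACA. Qed.
Next Obligation. by move=> X Y f x; rewrite /= raddfD. Qed.
Next Obligation. by move=> X Y f x; rewrite /= raddfD. Qed.
Next Obligation. by move=> X; rewrite /= addr0. Qed.
Next Obligation.
move=> X x y; congr pair; have /= ex := fpP x; have /= ey := fpP y.
by rewrite /= !(dp_Dr (gm_dp M)) -ex -ey addrACA.
Qed.
Next Obligation.
move=> X Y f a x; congr pair; have /= ex := fpP x.
by rewrite /= -ex (dp_Dr (gm_dp M)) raddfD.
Qed.

Program Definition sqz_opp_map : tbmap sqz sqz :=
  @TbMap gT O sqz sqz (@MkMap gT sqz sqz (fun X x => (x.1, - x.2)) _ _ _) _ _ _.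
Next Obligation. by move=> X x y; congr pair; rewrite /= opprD. Qed.
Next Obligation. by move=> X Y f x; rewrite /= raddfN. Qed.
Next Obligation. by move=> X Y f x; rewrite /= raddfN. Qed.
Next Obligation. by move=> X; rewrite /= oppr0. Qed.
Next Obligation.
by move=> X x y; congr pair; rewrite /= !(dp_Nr (gm_dp M)) -opprD.
Qed.
Next Obligation.
by move=> X Y f a x; congr pair; rewrite /= (dp_Nr (gm_dp M)) raddfN.
Qed.

Program Definition sqz_add :
    hom (prod_ob (calg_over_products B) sqz_over sqz_over) sqz_over :=
  OverHom (UnderHom sqz_add_map _) _.
Next Obligation. by apply: tbm_eq => X x; rewrite /= addr0. Qed.
Next Obligation. by apply: under_eq; apply: tbm_eq. Qed.

Program Definition sqz_zero : hom (one_ob (calg_over_products B)) sqz_over :=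
  OverHom (UnderHom sqz_incl _) _.
Next Obligation. by apply: tbm_eq. Qed.
Next Obligation. by apply: under_eq; apply: tbm_eq. Qed.

Program Definition sqz_opp : hom sqz_over sqz_over :=
  OverHom (UnderHom sqz_opp_map _) _.
Next Obligation. by apply: tbm_eq => X x; rewrite /= oppr0. Qed.
Next Obligation. by apply: under_eq; apply: tbm_eq. Qed.

Lemma over_sqz_add X x : over_tbmap sqz_add X x =
  ((over_prod_val x).1.1, (over_prod_val x).1.2 + (over_prod_val x).2.2).
Proof. by []. Qed.

Lemma over_sqz_zero X b : over_tbmap sqz_zero X b = (b, 0).
Proof. by []. Qed.

Lemma over_sqz_opp X x : over_tbmap sqz_opp X x = (x.1, - x.2).
Proof. by []. Qed.

Let sqzE := (over_tbmapE, over_sqz_add, over_sqz_zero, over_sqz_opp).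

Program Definition sqz_ab : calg_ab B :=
  @AbOb (calg_over B) (calg_over_products B) sqz_over sqz_add sqz_zero sqz_opp
    _ _ _ _.
Next Obligation. by apply: over_tbmap_inj => X x; rewrite !sqzE addrA. Qed.
Next Obligation.
apply: over_tbmap_inj => X x; rewrite !sqzE addrC; congr pair.
by have := over_prodP x.
Qed.
Next Obligation.
by apply: over_tbmap_inj => X [b m]; rewrite !sqzE addr0.
Qed.
Next Obligation.
by apply: over_tbmap_inj => X [b m]; rewrite !sqzE subrr.
Qed.
End SquareZero.

Section SquareZeroFunctor.
Hypothesis ax : forall M : gmod Bt, tambara_axioms (@sqz_norm M).

Program Definition sqz_map (M N : gmod Bt) (u : gmod_hom M N) :
  hom (sqz_ab (ax M)) (sqz_ab (ax N)) :=
  AbHom (OverHom (UnderHom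
    (@TbMap gT O (sqz (ax M)) (sqz (ax N))
      (@MkMap gT (sqz (ax M)) (sqz (ax N))
         (fun X x => (x.1, u X x.2)) _ _ _) _ _ _) _) _) _.
Next Obligation. by move=> M N u X x y; congr pair; rewrite /= raddfB. Qed.
Next Obligation. by move=> M N u X Y f x; rewrite /= mkm_res. Qed.
Next Obligation. by move=> M N u X Y f x; rewrite /= mkm_tr. Qed.
Next Obligation. by move=> M N u X; rewrite /= raddf0. Qed.
Next Obligation.
by move=> M N u X x y; rewrite /= raddfD /= !(gmh_act u).
Qed.
Next Obligation.
by move=> M N u X Y f a x; rewrite /= mkm_tr (gmh_act u).
Qed.
Next Obligation. by move=> M N u; apply: tbm_eq => X x; rewrite /= raddf0. Qed.
Next Obligation. by move=> M N u; apply: under_eq; apply: tbm_eq. Qed.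
Next Obligation.
move=> M N u; apply: over_eq; apply: under_eq; apply: tbm_eq => X x.
by rewrite /= raddfD.
Qed.

Lemma over_sqz_map (M N : gmod Bt) (u : gmod_hom M N) X
    (x : over_tambara (sqz_over (ax M)) X) :
  over_tbmap (ab_fun (sqz_map u)) X x = (x.1, u X x.2).
Proof. by []. Qed.

Hypothesis van : forall M, kernel_norms_vanish (sqz_ab (ax M)).

Program Definition sqz_functor : functor (gmod_cat Bt) calg_ab_vanishing :=
  @Functor (gmod_cat Bt) calg_ab_vanishing (fun M => exist _ (sqz_ab (ax M)) (@van M))
    (fun M N u => sqz_map u) _ _.
Next Obligation.
by move=> M; apply: ab_hom_eq; apply: over_tbmap_inj => X [b m].
Qed.
Next Obligation.
move=> M N P v u; apply: ab_hom_eq; rewrite ab_compE; apply: over_tbmap_inj.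
by move=> X x; rewrite over_tbmap_comp !over_sqz_map gmod_compE.
Qed.
End SquareZeroFunctor.

End Main.

(* Main.v *)
Require Import Defs.
From mathcomp Require Import all_boot all_algebra all_fingroup.
From mathcomp Require Import boolp.

Set Implicit Arguments.
Unset Strict Implicit.
Unset Printing Implicit Defensive.

Import GRing.Theory Defs.

#[local] Obligation Tactic := idtac.

(** Let f : X -> Y be admissible.  Fibrewise, the norm N_f multiplies the values
  of b over the points of a fibre, so to first order in m

    N_f (b + m) = N_f b + T_f (D_f b . m),   D_f b = N_pi1 (R_pi2 b),

  where D_f b (norm_deriv below) multiplies the values of b over the other
  points of the fibre, and pi1, pi2 are the projections from the complement of
  the diagonal in X x_Y X.  The square-zero extension is defined by this
  expansion, and the proof consists of the calculus of D_f.

  That the norms of B |x M satisfy the axioms of a Tambara functor is a list of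
  properties of D_f: a chain rule (norm_deriv_comp), a product rule resting on
  R_f N_f b = b D_f b (res_norm), compatibility with base change
  (res_norm_deriv), and a formula for D_f of a transfer (norm_deriv_tr).  Each
  one comes from a decomposition or a base change of off-diagonal G-sets.  The
  norms of elements (0, m) along 2-surjective maps vanish because then pi1 is
  surjective, and the norm of 0 along a surjective map is 0.

  Conversely, let R be an abelian group object over B with zero section s and
  kernel I.  Additivity of the group law and its unit law force the group law
  to be x + y - s (aug x) (ab_add_total), and every element is uniquely s b + x
  with x in I, so it remains to compare products and norms.  Products of
  elements of I are norms along fold maps, which are 2-surjective, so I has
  square zero.  For norms, reciprocity for the fold map of X expresses N_f (s b + x) as a
  transfer from the G-set of subsets U of fibres of f, of the product of x over
  U and of s b outside U.  Subsets with at least two points contribute norms of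
  x along a 2-surjective map, hence 0; the empty set contributes N_f (s b) and
  the singletons T_f (D_f (s b) . x) (norm_add).  Hence (b, x) |-> s b + x is a
  natural isomorphism from B |x I onto R; the isomorphism of M with the kernel
  of B |x M -> B is immediate. *)

(** * Finite G-sets *)

Section GSets.
Local Open Scope group_scope.
Variable gT : finGroupType.
Implicit Types X Y Z W : gset gT.

Lemma gmapE X Y (f : gmap X Y) x a : f (hact x a) = hact (f x) a.
Proof. by rewrite hmapP ?inE. Qed.

Lemma hact_inj X a : injective (fun x : X => hact x a).
Proof. by move=> x y; exact: (act_inj (hset_act X) a). Qed.

Lemma hact_sumE X Y (s : hsum X Y) a :
  hact s a = match s with inl x => inl (hact x a) | inr y => inr (hact y a) end.
Proof. by rewrite mk_hsetE //; case: s. Qed.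

Section Sub.
Variables (X : gset gT) (P : pred X).
Hypothesis stP : forall x a, P (hact x a) = P x.

Definition hsub_act (u : {x | P x}) (a : gT) : {x | P x} :=
  insubd u (hact (val u) a).

Lemma val_hsub_act u a : val (hsub_act u a) = hact (val u) a.
Proof. by rewrite val_insubd stP (valP u). Qed.

Program Definition hsub : gset gT := @mk_hset gT _ {x | P x} hsub_act _ _.
Next Obligation. by move=> u; apply: val_inj; rewrite val_hsub_act hact1. Qed.
Next Obligation.
by move=> u a b ha hb; apply: val_inj; rewrite !val_hsub_act hactM.
Qed.

Program Definition hsub_val : gmap hsub X := @HMap gT _ hsub X val _.
Next Obligation. by move=> u a ha; rewrite mk_hsetE // val_hsub_act. Qed.

Program Definition hsub_lift W (f : gmap W X) (Pf : forall w, P (f w)) :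
  gmap W hsub := @HMap gT _ W hsub (fun w => exist _ (f w) (Pf w)) _.
Next Obligation.
move=> W f Pf w a ha; apply: val_inj; rewrite mk_hsetE // val_hsub_act /=.
exact: gmapE.
Qed.

End Sub.

Program Definition hprod X Y : gset gT :=
  @mk_hset gT _ (X * Y)%type (fun p a => (hact p.1 a, hact p.2 a)) _ _.
Next Obligation. by move=> X Y [x y]; rewrite !hact1. Qed.
Next Obligation. by move=> X Y [x y] a b ha hb; rewrite !hactM. Qed.

Lemma hact_prodE X Y (p : hprod X Y) a : hact p a = (hact p.1 a, hact p.2 a).
Proof. by rewrite mk_hsetE. Qed.

Program Definition hfst X Y : gmap (hprod X Y) X := @HMap gT _ (hprod X Y) X fst _.
Next Obligation. by move=> X Y p a ha; rewrite hact_prodE. Qed.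

Program Definition hsnd X Y : gmap (hprod X Y) Y := @HMap gT _ (hprod X Y) Y snd _.
Next Obligation. by move=> X Y p a ha; rewrite hact_prodE. Qed.

Program Definition hpair W X Y (f : gmap W X) (g : gmap W Y) : gmap W (hprod X Y) :=
  @HMap gT _ W (hprod X Y) (fun w => (f w, g w)) _.
Next Obligation. by move=> W X Y f g w a ha; rewrite hact_prodE !gmapE. Qed.

Program Definition hpow X : gset gT :=
  @mk_hset gT _ {set X} (fun U a => [set hact x a | x in U]) _ _.
Next Obligation.
move=> X U; rewrite -[RHS]imset_id; apply: eq_imset => x; exact: hact1.
Qed.
Next Obligation.
move=> X U a b ha hb; rewrite /= -imset_comp; apply: eq_imset => x /=.
exact: hactM.
Qed.

Lemma hact_powE X (U : hpow X) a : hact U a = [set hact x a | x in U] :> {set X}.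
Proof. by rewrite mk_hsetE. Qed.

Lemma mem_hact_pow X (U : hpow X) x a :
  (hact x a \in (hact U a : {set X})) = (x \in (U : {set X})).
Proof. by rewrite hact_powE (mem_imset _ _ (@hact_inj X a)). Qed.

Section Pullback.
Variables (X Y Z : gset gT) (f : gmap X Z) (g : gmap Y Z).

Lemma hpb_stable (p : hprod X Y) a :
  (f (hact p a).1 == g (hact p a).2) = (f p.1 == g p.2).
Proof. by rewrite hact_prodE /= !gmapE (inj_eq (@hact_inj Z a)). Qed.

Definition hpb : gset gT :=
  @hsub (hprod X Y) (fun p => f p.1 == g p.2) hpb_stable.
Definition hpb1 : gmap hpb X := hcomp (hfst X Y) (hsub_val hpb_stable).
Definition hpb2 : gmap hpb Y := hcomp (hsnd X Y) (hsub_val hpb_stable).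

Lemma hpb_sq (w : hpb) : f (hpb1 w) = g (hpb2 w).
Proof. exact/eqP/(valP w). Qed.

Lemma hpb_eq (v w : hpb) : hpb1 v = hpb1 w -> hpb2 v = hpb2 w -> v = w.
Proof. by case: v w => [[x y] h] [[x' y'] h'] /= e1 e2; apply: val_inj; congr pair. Qed.

Lemma hpb_lift_subproof W (u : gmap W X) (v : gmap W Y) :
  (forall w, f (u w) = g (v w)) -> forall w, f (hpair u v w).1 == g (hpair u v w).2.
Proof. by move=> e w; exact/eqP/e. Qed.

Definition hpb_lift W (u : gmap W X) (v : gmap W Y)
    (e : forall w, f (u w) = g (v w)) : gmap W hpb :=
  hsub_lift hpb_stable (hpb_lift_subproof e).

Lemma hpbP : is_pullback f g hpb2 hpb1.
Proof.
split=> [|x y e]; first exact: hpb_sq.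
have h : f (x, y).1 == g (x, y).2 by exact/eqP.
exists (exist _ (x, y) h); split=> // w [e1 e2].
by apply: hpb_eq.
Qed.
End Pullback.

Lemma is_pullbackC X Y Z W (f : gmap X Z) (g : gmap Y Z) (f' : gmap W Y)
  (g' : gmap W X) : is_pullback f g f' g' -> is_pullback g f g' f'.
Proof.
case=> sq un; split=> [w|y x e]; first by rewrite sq.
have [w [[e1 e2] u]] := un _ _ (esym e).
by exists w; split=> // w' [e3 e4]; exact: u.
Qed.

Lemma pullback_inj X Y Z W (f : gmap X Z) (g : gmap Y Z) (f' : gmap W Y)
  (g' : gmap W X) : is_pullback f g f' g' ->
  forall w w', g' w = g' w' -> f' w = f' w' -> w = w'.
Proof.
case=> sq un w w' e1 e2; have [v [_ u]] := un _ _ (sq w').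
by rewrite -(u w) // -(u w').
Qed.

(** A binary coproduct diagram, recognised on points so that it can be checked
  without exhibiting an isomorphism with hsum X1 X2. *)
Definition complementary X X1 X2 (i1 : gmap X1 X) (i2 : gmap X2 X) : Prop :=
  [/\ injective i1, injective i2, forall x1 x2, i1 x1 <> i2 x2
    & forall x, (exists x1, i1 x1 = x) \/ (exists x2, i2 x2 = x)].

Lemma gmap_inverse X Y (f : gmap X Y) :
  injective f -> (forall y, exists x, f x = y) ->
  exists g : gmap Y X, cancel f g /\ cancel g f.
Proof.
move=> f_inj f_surj; have [g gK] := choice f_surj.
have gP y a : a \in [set: gT]%G -> g (hact y a) = hact (g y) a.
  by move=> _; apply: f_inj; rewrite gmapE !gK.
exists (HMap gP); split=> //= x; apply: f_inj; exact: gK.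
Qed.

Program Definition hcase X Y Z (f : gmap X Z) (g : gmap Y Z) : gmap (hsum X Y) Z :=
  @HMap gT _ (hsum X Y) Z (fun s => match s with inl x => f x | inr y => g y end) _.
Next Obligation. by move=> X Y Z f g [x|y] a ha; rewrite hact_sumE /= gmapE. Qed.

Program Definition hvoid X : gmap (htriv [set: gT]%G void) X :=
  @HMap gT _ (htriv [set: gT]%G void) X (fun v => match v with end) _.
Next Obligation. by move=> X []. Qed.

Lemma complementary_sum X Y : complementary (hinl X Y) (hinr X Y).
Proof.
split=> [x y [] //|x y [] //|//|[x|y]]; [by left; exists x|by right; exists y].
Qed.

Lemma complementary_sub X (P : pred X) (stP : forall x a, P (hact x a) = P x)
    (stN : forall x a, ~~ P (hact x a) = ~~ P x) :
  complementary (hsub_val stP) (hsub_val stN).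
Proof.
split=> [||[x hx] [y hy] /= e|x]; [exact: val_inj|exact: val_inj| |].
  by rewrite e (negPf hy) in hx.
by case: (boolP (P x)) => h; [left|right]; exists (exist _ x h).
Qed.

Lemma admissible_pullback (O : indexing_system gT) X Y Z W (f : gmap X Z)
    (g : gmap Y Z) (f' : gmap W Y) (g' : gmap W X) :
  is_pullback f g f' g' -> admissible O f -> admissible O f'.
Proof.
by move=> pb; apply: admissible_base (pullback_inj pb); case: pb.
Qed.

Lemma admissible_restrict (O : indexing_system gT) X Y W (f : gmap X Y)
    (i : gmap W X) (h : gmap W Y) :
  injective i -> (forall w, f (i w) = h w) -> admissible O f -> admissible O h.
Proof.
move=> i_inj e; apply: (@admissible_base _ O X Y Y W f (hid Y) h i) => //.
by move=> w w' /i_inj.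
Qed.

(** The orbits of such a map over point stabilisers are single points. *)
Lemma admissible_stab (O : indexing_system gT) X Y (f : gmap X Y) :
  (forall x, gstab (f x) \subset gstab x) -> admissible O f.
Proof.
move=> sub x; set H := gstab (f x); set K := gstab x.
have HK : H \subset K := sub x.
have KH : K \subset H.
  by apply/subsetP => a /gstabP e; apply/gstabP; rewrite -gmapE e.
have memH : H :* 1 \in rcosets K H.
  apply/rcosetsP; exists 1; first exact: group1.
  by congr (_ :* _); apply/eqP; rewrite eqEsubset HK KH.
pose pt : hcoset H K := exist (fun C => C \in rcosets K H) _ memH.
have all_eq (C D : hcoset H K) : C = D.
  case: C D => [C hC] [D hD]; apply: val_inj => /=.
  case/rcosetsP: hC => h hh ->; case/rcosetsP: hD => g hg ->.
  by rewrite !rcoset_id ?(subsetP HK).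
pose c (_ : htriv H unit) : hcoset H K := pt.
have cP t a : a \in H -> c (hact t a) = hact (c t) a by move=> _; exact: all_eq.
apply: (@ix_iso _ O H (htriv H unit) _ (HMap cP)); last exact: ix_triv.
by exists (fun=> tt) => [[]|C] //; exact: all_eq.
Qed.

Lemma admissible_inj (O : indexing_system gT) X Y (f : gmap X Y) :
  injective f -> admissible O f.
Proof.
move=> f_inj; apply: admissible_stab => x; apply/subsetP => a /gstabP e.
by apply/gstabP; apply: f_inj; rewrite gmapE.
Qed.

Lemma admissible_fold (O : indexing_system gT) X : admissible O (hfold X).
Proof.
apply: admissible_stab => s; apply/subsetP => a /gstabP e; apply/gstabP.
by case: s e => x /= e; rewrite hact_sumE e.
Qed.
End GSets.
Arguments hpb_lift {gT X Y Z} f g {W} u v e.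

(** * Mackey functors and norms on finite G-sets *)

Section Mackey.
Local Open Scope ring_scope.
Variables (gT : finGroupType) (M : mackey gT).
Implicit Types X Y Z W : gset gT.

Lemma mk_res_compE X Y Z (g : gmap Y Z) (f : gmap X Y) (h : gmap X Z) x :
  (forall t, g (f t) = h t) -> mk_res M f (mk_res M g x) = mk_res M h x.
Proof. by move=> e; rewrite -mk_res_comp; congr mk_res; exact: hmap_eq. Qed.

Lemma mk_tr_compE X Y Z (g : gmap Y Z) (f : gmap X Y) (h : gmap X Z) x :
  (forall t, g (f t) = h t) -> mk_tr M g (mk_tr M f x) = mk_tr M h x.
Proof. by move=> e; rewrite -mk_tr_comp; congr mk_tr; exact: hmap_eq. Qed.

(** The Mackey axioms give this only for one chosen empty G-set. *)
Lemma mk_empty W (x : M W) : (W -> False) -> x = 0.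
Proof.
move=> w0.
have gP w a : a \in [set: gT]%G ->
    (match w0 (hact w a) with end : htriv [set: gT]%G void) =
    hact (match w0 w with end) a by case: (w0 w).
have -> : x = mk_res M (HMap gP) (mk_res M (hvoid W) x).
  by rewrite (mk_res_compE (h := hid W)) ?mk_res_id // => w; case: (w0 w).
by rewrite (mk_void (mk_res M (hvoid W) x)) raddf0.
Qed.

Lemma mk_res_sum_inj X Y (z t : M (hsum X Y)) :
  mk_res M (hinl X Y) z = mk_res M (hinl X Y) t ->
  mk_res M (hinr X Y) z = mk_res M (hinr X Y) t -> z = t.
Proof.
move=> e1 e2; have [w [_ u]] := mk_sum (mk_res M (hinl X Y) t) (mk_res M (hinr X Y) t).
by rewrite -(u z) // -(u t).
Qed.

Section Complementary.
Variables (X X1 X2 : gset gT) (i1 : gmap X1 X) (i2 : gmap X2 X).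
Hypothesis i12 : complementary i1 i2.

Lemma complementary_case_bij :
  exists g : gmap X (hsum X1 X2), cancel (hcase i1 i2) g /\ cancel g (hcase i1 i2).
Proof.
case: i12 => inj1 inj2 dj cov; apply: gmap_inverse.
  move=> [x1|x2] [y1|y2] /= e; first by rewrite (inj1 _ _ e).
  - by case: (dj _ _ e).
  - by case: (dj _ _ (esym e)).
  - by rewrite (inj2 _ _ e).
by move=> x; case: (cov x) => [[x1 <-]|[x2 <-]]; [exists (inl x1)|exists (inr x2)].
Qed.

Lemma mk_res_compl_inj (z t : M X) :
  mk_res M i1 z = mk_res M i1 t -> mk_res M i2 z = mk_res M i2 t -> z = t.
Proof.
move=> e1 e2; have [g [_ gK]] := complementary_case_bij.
have gcK w : mk_res M g (mk_res M (hcase i1 i2) w) = w.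
  by rewrite (mk_res_compE (h := hid X)) ?mk_res_id.
rewrite -[z]gcK -[t]gcK; congr (mk_res M g _).
by apply: mk_res_sum_inj; rewrite !(mk_res_compE (h := i1), mk_res_compE (h := i2)).
Qed.

Lemma pullback_void : is_pullback i2 i1 (hvoid X1) (hvoid X2).
Proof. by split=> [[]|x2 x1 e]; case: i12 => _ _ /(_ x1 x2)/(_ (esym e)). Qed.
End Complementary.

Lemma complementaryC X X1 X2 (i1 : gmap X1 X) (i2 : gmap X2 X) :
  complementary i1 i2 -> complementary i2 i1.
Proof.
case=> inj1 inj2 dj cov; split=> // [x2 x1 e|x]; first exact: (dj x1 x2).
by case: (cov x); [right|left].
Qed.

Lemma pullback_inj_id X W (i : gmap W X) :
  injective i -> is_pullback i i (hid W) (hid W).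
Proof.
by move=> inj; split=> // x y /inj ->; exists y; split=> // w [].
Qed.

(** A coproduct decomposition X = X1 + X2 makes M X a biproduct, with
  injections the transfers and projections the restrictions. *)
Lemma mk_split X X1 X2 (i1 : gmap X1 X) (i2 : gmap X2 X) (z : M X) :
  complementary i1 i2 ->
  z = mk_tr M i1 (mk_res M i1 z) + mk_tr M i2 (mk_res M i2 z).
Proof.
move=> i12; have [inj1 inj2 _ _] := i12.
apply: (mk_res_compl_inj i12); rewrite raddfD /=.
  rewrite (mk_dc (pullback_inj_id inj1)) (mk_dc (pullback_void i12)).
  rewrite (mk_void (mk_res M (hvoid X2) _)) raddf0 addr0.
  by rewrite mk_tr_id mk_res_id.
rewrite (mk_dc (pullback_inj_id inj2)) (mk_dc (pullback_void (complementaryC i12))).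
rewrite (mk_void (mk_res M (hvoid X1) _)) raddf0 add0r.
by rewrite mk_tr_id mk_res_id.
Qed.

Lemma mk_tr_split X Y X1 X2 (i1 : gmap X1 X) (i2 : gmap X2 X) (q : gmap X Y)
    (q1 : gmap X1 Y) (q2 : gmap X2 Y) (z : M X) :
  complementary i1 i2 -> (forall t, q (i1 t) = q1 t) ->
  (forall t, q (i2 t) = q2 t) ->
  mk_tr M q z = mk_tr M q1 (mk_res M i1 z) + mk_tr M q2 (mk_res M i2 z).
Proof.
move=> i12 e1 e2; rewrite [in LHS](mk_split z i12) raddfD /=.
by rewrite (mk_tr_compE _ e1) (mk_tr_compE _ e2).
Qed.
End Mackey.

Section Norms.
Local Open Scope ring_scope.
Variables (gT : finGroupType) (O : indexing_system gT) (R : tambara O).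
Implicit Types X Y Z W : gset gT.
Let ax := tb_ax R.

Lemma norm_idE X (f : gmap X X) (a : admissible O f) x :
  f =1 id -> tb_norm R a x = x.
Proof.
move=> e; have e' : f = hid X by exact: hmap_eq.
by case: _ / (esym e') a => a; exact: (norm_id ax).
Qed.

Lemma norm_compE X Y Z (g : gmap Y Z) (f : gmap X Y) (h : gmap X Z)
    (ag : admissible O g) (af : admissible O f) (ah : admissible O h) x :
  (forall t, g (f t) = h t) -> tb_norm R ag (tb_norm R af x) = tb_norm R ah x.
Proof.
move=> e; have e' : hcomp g f = h by exact: hmap_eq.
by case: _ / e' ah => ah; rewrite (norm_comp ax ag af).
Qed.

Lemma gr_mulr1 X (x : R X) : gr_mul x (gr_one R X) = x.
Proof. by rewrite gr_mulC gr_mul1. Qed.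

Lemma norm_empty X Y (f : gmap X Y) (a : admissible O f) x :
  (X -> False) -> tb_norm R a x = gr_one R Y.
Proof.
by move=> x0; rewrite (mk_empty x x0) -(mk_empty (gr_one R X) x0) (norm1 ax).
Qed.

(** 0 is a transfer from the empty G-set, and the dependent product along a
  surjective map of an empty G-set is empty. *)
Lemma norm_surj0 X Y (f : gmap X Y) (a : admissible O f) :
  (forall y, exists x, f x = y) -> tb_norm R a 0 = 0.
Proof.
move=> surj; set V := htriv [set: gT]%G void.
have ex : is_exponential (hvoid X) f (hvoid Y) (hid V) (hvoid X) (hid V).
  split=> [|[]|y s]; last by case: (surj y) => x /eqP e; case: (s (exist _ x e)).
  by split=> [[]|x []].
have ap : admissible O (hid V) by apply: admissible_inj.
have := norm_tr ax ex a ap 0; rewrite raddf0 => ->.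
by rewrite (mk_void (tb_norm R ap _)) raddf0.
Qed.

(** The square formed by f, its inverse and two identities is a pullback. *)
Lemma norm_iso X Y (f : gmap X Y) (g : gmap Y X) (a : admissible O f) x :
  cancel f g -> cancel g f -> tb_norm R a x = mk_res R g x.
Proof.
move=> fK gK.
have pb : is_pullback f (hid Y) (hid Y) g.
  split=> [y|z y e]; first exact: gK.
  have {}e : f z = y := e.
  by exists y; split=> [|w []] //; rewrite -e fK.
have ai : admissible O (hid Y) by exact: admissible_inj.
by rewrite -[LHS]mk_res_id (norm_dc ax pb a ai) norm_idE.
Qed.

(** f factors as the sum of its two restrictions, X1 + X2 -> Y + Y, followed by
  the fold map, whose norm is the multiplication. *)
Lemma norm_split X Y X1 X2 (i1 : gmap X1 X) (i2 : gmap X2 X) (f : gmap X Y)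
    (f1 : gmap X1 Y) (f2 : gmap X2 Y) (a : admissible O f)
    (a1 : admissible O f1) (a2 : admissible O f2) (x : R X) :
  complementary i1 i2 -> (forall t, f (i1 t) = f1 t) ->
  (forall t, f (i2 t) = f2 t) ->
  tb_norm R a x =
    gr_mul (tb_norm R a1 (mk_res R i1 x)) (tb_norm R a2 (mk_res R i2 x)).
Proof.
move=> i12 e1 e2; have [g [cK gK]] := complementary_case_bij i12.
(* the sum X1 + X2 -> Y + Y of the restrictions *)
pose k := hcase (hcomp (hinl Y Y) f1) (hcomp (hinr Y Y) f2).
have ac : admissible O (hcase i1 i2) by apply/admissible_inj/(can_inj cK).
have ak : admissible O k.
  apply: (@admissible_base _ O _ _ _ _ f (hfold Y) k (hcase i1 i2)) a.
    by case=> t /=; rewrite ?e1 ?e2.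
  by move=> w w' /(can_inj cK).
pose y := mk_res R (hcase i1 i2) x.
have xE : x = tb_norm R ac y.
  by rewrite (norm_iso _ _ cK gK) (mk_res_compE (h := hid X)) ?mk_res_id.
have ah : admissible O (hcomp (hfold Y) k).
  by apply: admissible_restrict (can_inj cK) _ a => -[t|t] /=; rewrite ?e1 ?e2.
have af := @admissible_fold gT O Y.
rewrite [in LHS]xE (norm_compE _ _ ah); last by case=> t /=; rewrite ?e1 ?e2.
rewrite (norm_comp ax af ak) (norm_fold ax); congr gr_mul.
  have pb : is_pullback k (hinl Y Y) f1 (hinl X1 X2).
    split=> // -[t|t] u //= [e]; exists t; split; first by rewrite e.
    by move=> w [[]].
  by rewrite (norm_dc ax pb ak a1); congr tb_norm; apply: mk_res_compE.
have pb : is_pullback k (hinr Y Y) f2 (hinr X1 X2).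
  split=> // -[t|t] u //= [e]; exists t; split; first by rewrite e.
  by move=> w [[]].
by rewrite (norm_dc ax pb ak a2); congr tb_norm; apply: mk_res_compE.
Qed.
End Norms.

(** * The derivative of a norm *)

Section OffDiagonal.
Variables (gT : finGroupType).
Implicit Types X Y Z W : gset gT.

Lemma offdiag_eq X Y (f : gmap X Y) (p q : offdiag f) :
  offdiag1 f p = offdiag1 f q -> offdiag2 f p = offdiag2 f q -> p = q.
Proof.
by case: p q => [[x y] h] [[x' y'] h'] /= e1 e2; apply: val_inj; congr pair.
Qed.

Lemma offdiag_sq X Y (f : gmap X Y) (p : offdiag f) :
  f (offdiag1 f p) = f (offdiag2 f p).
Proof. by case/andP: (valP p) => /eqP. Qed.

Lemma offdiag_neq X Y (f : gmap X Y) (p : offdiag f) :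
  offdiag1 f p <> offdiag2 f p.
Proof. by case/andP: (valP p) => _ /eqP. Qed.

Lemma offdiag_pairP X Y (f : gmap X Y) (x x' : X) :
  f x = f x' -> x <> x' -> (f x == f x') && (x != x').
Proof. by move=> /eqP -> /eqP. Qed.

Program Definition offdiag_pair W X Y (f : gmap X Y) (u v : gmap W X)
    (e : forall w, f (u w) = f (v w)) (n : forall w, u w <> v w) :
  gmap W (offdiag f) :=
  @HMap gT _ W (offdiag f)
    (fun w => exist _ (u w, v w) (offdiag_pairP (e w) (n w))) _.
Next Obligation.
move=> W X Y f u v e n w a ha; apply: val_inj.
by rewrite mk_hsetE // val_offdiag_act /= !gmapE.
Qed.
End OffDiagonal.

Section NormDerivative.
Local Open Scope ring_scope.
Variables (gT : finGroupType) (O : indexing_system gT) (R : tambara O).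
Implicit Types X Y Z W : gset gT.
Let ax := tb_ax R.

(** Over x, the product of b over the other points of the fibre through x: to
  first order in m, N_f (b + m) is N_f b plus the transfer along f of
  norm_deriv b times m. *)
Definition norm_deriv X Y (f : gmap X Y) (a : admissible O f) (b : R X) : R X :=
  tb_norm R (offdiag1_admissible a) (mk_res R (offdiag2 f) b).

Lemma norm_deriv_inj X Y (f : gmap X Y) (a : admissible O f) b :
  injective f -> norm_deriv a b = gr_one R X.
Proof.
move=> inj; apply: norm_empty => p.
by case: (offdiag_neq (p := p)); apply: inj; exact: offdiag_sq.
Qed.

Lemma norm_derivM X Y (f : gmap X Y) (a : admissible O f) b c :
  norm_deriv a (gr_mul b c) = gr_mul (norm_deriv a b) (norm_deriv a c).
Proof. by rewrite /norm_deriv (dp_res (gr_dp R)) (normM ax). Qed.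

(** By base change the left side is a norm along X x_Y X -> X, and X x_Y X is the
  diagonal plus the off-diagonal part. *)
Lemma res_norm X Y (f : gmap X Y) (a : admissible O f) b :
  mk_res R f (tb_norm R a b) = gr_mul b (norm_deriv a b).
Proof.
have pb := hpbP f f; have a' := admissible_pullback pb a.
pose i1 := hpb_lift f f (hid X) (hid X) (fun=> erefl).
pose i2 := hpb_lift f f (offdiag2 f) (offdiag1 f) (fun p => esym (offdiag_sq p)).
have i12 : complementary i1 i2.
  split=> [x y /(congr1 val) [] //|p q /(congr1 val) /= [e2 e1]|x p|w].
  - exact: offdiag_eq.
  - move=> /(congr1 val) /= [e2 e1]; case: (offdiag_neq (p := p)).
    exact: etrans (esym e1) e2.
  case: w => [[x' x] e]; case: (x =P x') => [ex|n].
    by left; exists x; apply: val_inj; rewrite /= ex.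
  right; have h : (f x == f x') && (x != x').
    by apply/offdiag_pairP => //; exact/esym/eqP.
  by exists (exist _ (x, x') h); apply: val_inj.
rewrite (norm_dc ax pb a a').
have ai : admissible O (hid X) by exact: admissible_inj.
rewrite (norm_split a' ai (offdiag1_admissible a) _ i12) // norm_idE //.
congr gr_mul; first by rewrite (mk_res_compE (h := hid X)) ?mk_res_id.
by congr tb_norm; apply: mk_res_compE.
Qed.

(** The chain rule.  Distinct points of a fibre of g f either agree under f, or
  are sent by f to distinct points of a fibre of g.  A pair (x, x') of the
  second kind amounts to a point x and, over y = f x, a point x' with y and
  f x' distinct in one fibre of g. *)
Lemma norm_deriv_comp X Y Z (g : gmap Y Z) (f : gmap X Y) (h : gmap X Z)
    (ag : admissible O g) (af : admissible O f) (ah : admissible O h) b :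
  (forall x, g (f x) = h x) ->
  norm_deriv ah b = gr_mul (mk_res R f (norm_deriv ag (tb_norm R af b)))
                           (norm_deriv af b).
Proof.
move=> gf; rewrite gr_mulC.
pose P (p : offdiag h) := f (offdiag1 h p) == f (offdiag2 h p).
have stP p a : P (hact p a) = P p.
  by rewrite /P !gmapE (inj_eq (@hact_inj _ _ a)).
pose Q p := ~~ P p; have stQ p a : Q (hact p a) = Q p by rewrite /Q stP.
have i1e p : h (offdiag1 f p) = h (offdiag2 f p) by rewrite -!gf offdiag_sq.
pose i1 : gmap (offdiag f) (offdiag h) := offdiag_pair i1e (@offdiag_neq _ _ _ f).
pose i2 := hsub_val stQ.
have i12 : complementary i1 i2.
  split=> [p q e|p q|p [q hq] e|p].
  - by case: (congr1 val e) => e1 e2; apply: offdiag_eq.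
  - exact: val_inj.
  - by have /eqP[] := hq; rewrite -[q]e; exact: offdiag_sq.
  case: (boolP (P p)) => hp; last by right; exists (exist _ p hp).
  left; have hp' : (f (val p).1 == f (val p).2) && ((val p).1 != (val p).2).
    by rewrite [_ == _]hp /=; exact/eqP/offdiag_neq.
  by exists (exist _ (val p) hp'); apply: offdiag_eq.
pose k := hcomp (offdiag1 h) i2.
have ak : admissible O k.
  apply: (@admissible_restrict _ O _ _ _ (offdiag1 h) i2 k) => [||].
  - exact: val_inj.
  - by [].
  - exact: offdiag1_admissible.
rewrite /norm_deriv.
rewrite (norm_split (offdiag1_admissible ah) (offdiag1_admissible af) ak _ i12) //.
congr gr_mul; first by congr tb_norm; exact: mk_res_compE.
(* pairs (y, x') with y and f x' distinct in one fibre of g *)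
have pb1 := is_pullbackC (hpbP (offdiag2 g) f).
have av := admissible_pullback pb1 af.
rewrite (norm_dc ax pb1 af av).
set V := hpb _ _ in pb1 av *; set v1 := hpb1 _ _ in pb1 av *.
set v2 := hpb2 _ _ in pb1 *.
have am : admissible O (hcomp (offdiag1 g) v1).
  apply: (@admissible_base _ O _ _ _ _ h g _ v2).
  - by move=> w; rewrite -gf /= (offdiag_sq (v1 w)) (hpb_sq w).
  - move=> w w' e2 e1; apply: (@hpb_eq _ _ _ _ (offdiag2 g) f) => //.
    apply: offdiag_eq => //.
    by rewrite !hpb_sq; congr (f _).
  - exact: ah.
rewrite (norm_compE (offdiag1_admissible ag) av am) //.
have ge (w : hsub stQ) : g (f (offdiag1 h (i2 w))) = g (f (offdiag2 h (i2 w))).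
  by rewrite !gf offdiag_sq.
have gn (w : hsub stQ) : f (offdiag1 h (i2 w)) <> f (offdiag2 h (i2 w)).
  by move/eqP; exact/negP/(valP w).
pose d : gmap (hsub stQ) (offdiag g) :=
  @offdiag_pair _ _ _ _ g (hcomp f (hcomp (offdiag1 h) i2))
    (hcomp f (hcomp (offdiag2 h) i2)) ge gn.
pose e := hpb_lift (offdiag2 g) f d (hcomp (offdiag2 h) i2) (fun=> erefl).
have pb2 : is_pullback (hcomp (offdiag1 g) v1) f k e.
  split=> // v x /= ev.
  have hx : h x = h (v2 v) by rewrite -!gf -ev offdiag_sq [offdiag2 g _]hpb_sq.
  have nx : f x <> f (v2 v).
    by rewrite -ev -hpb_sq; exact: offdiag_neq.
  have nx' : x <> v2 v by move=> exv; apply: nx; rewrite exv.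
  pose w0 : offdiag h := exist _ (x, v2 v) (offdiag_pairP hx nx').
  have Qw : Q w0 by exact/eqP.
  exists (exist _ w0 Qw); split.
    split=> //; apply: (@hpb_eq _ _ _ _ (offdiag2 g) f) => //.
    apply: offdiag_eq; first exact: esym ev.
    exact: esym (hpb_sq v).
  move=> w [e1 e2]; apply: val_inj; apply: offdiag_eq => /=; first exact: esym e2.
  by rewrite -e1.
rewrite (norm_dc ax pb2 am ak); congr tb_norm.
rewrite (mk_res_compE (h := hcomp (offdiag2 h) i2)) //.
by rewrite (mk_res_compE (h := hcomp (offdiag2 h) i2)).
Qed.

(** A fibre of the fold map has two points, so the off-diagonal part is the
  graph of the swap. *)
Lemma norm_deriv_fold X (a : admissible O (hfold X)) b :
  norm_deriv a b = mk_res R (hcase (hinr X X) (hinl X X)) b.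
Proof.
pose sw := hcase (hinr X X) (hinl X X).
have swE s : hfold X s = hfold X (sw s) by case: s.
have swn s : s <> sw s by case: s.
pose g : gmap _ (offdiag (hfold X)) :=
  @offdiag_pair _ _ _ _ (hfold X) (hid _) sw swE swn.
have gK : cancel g (offdiag1 (hfold X)) by [].
have fK : cancel (offdiag1 (hfold X)) g.
  move=> p; apply: offdiag_eq => //.
  have := offdiag_sq p; have := offdiag_neq (p := p).
  by case: p => [[[s|s] [t|t]] h] //= n e; rewrite e // in n *.
by rewrite /norm_deriv (norm_iso _ _ fK gK); apply: mk_res_compE.
Qed.

(** Off-diagonal parts of pullbacks are pullbacks of off-diagonal parts. *)
Lemma res_norm_deriv X Y Z W (f : gmap X Z) (g : gmap Y Z) (f' : gmap W Y)
    (g' : gmap W X) (a : admissible O f) (a' : admissible O f') b :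
  is_pullback f g f' g' ->
  mk_res R g' (norm_deriv a b) = norm_deriv a' (mk_res R g' b).
Proof.
move=> pb; have [sq un] := pb; have inj := pullback_inj pb.
have ge (w : offdiag f') : f (g' (offdiag1 f' w)) = f (g' (offdiag2 f' w)).
  by rewrite !sq offdiag_sq.
have gn (w : offdiag f') : g' (offdiag1 f' w) <> g' (offdiag2 f' w).
  by move=> e; case: (offdiag_neq (p := w)); apply: inj => //; exact: offdiag_sq.
pose G : gmap (offdiag f') (offdiag f) :=
  @offdiag_pair _ _ _ _ f (hcomp g' (offdiag1 f')) (hcomp g' (offdiag2 f')) ge gn.
have pb' : is_pullback (offdiag1 f) g' (offdiag1 f') G.
  split=> // p w /= e.
  have [w' [[e1 e2] _]] : exists! w', g' w' = offdiag2 f p /\ f' w' = f' w.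
    by apply: un; rewrite -sq -e offdiag_sq.
  have nw : w <> w'.
    by move=> ew; case: (offdiag_neq (p := p)); rewrite /= e -[RHS]e1 -ew.
  exists (exist _ (w, w') (offdiag_pairP (esym e2) nw)); split.
    by split=> //; apply: offdiag_eq.
  move=> v [ev1 ev2]; apply: offdiag_eq => /=; first exact: esym ev2.
  apply: inj; first by rewrite e1 -ev1.
  by rewrite e2 -ev2 [f' (offdiag1 _ _)]offdiag_sq.
rewrite /norm_deriv (norm_dc ax pb' _ (offdiag1_admissible a')); congr tb_norm.
by rewrite -[RHS]mk_res_comp; apply: mk_res_compE.
Qed.
End NormDerivative.

Section NormDerivativeTransfer.
Local Open Scope ring_scope.
Variables (gT : finGroupType) (O : indexing_system gT) (R : tambara O).
Implicit Types X Y Z W : gset gT.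
Let ax := tb_ax R.

Lemma two_surjective_other X Y (f : gmap X Y) :
  two_surjective f -> forall x, exists x', f x' = f x /\ x' <> x.
Proof.
move=> f2 x; have := f2 (f x); rewrite (cardsD1 x) inE eqxx add1n ltnS.
by case/card_gt0P => x'; rewrite !inE => /andP[/eqP n /eqP e]; exists x'.
Qed.

Lemma two_surjective_surj X Y (f : gmap X Y) :
  two_surjective f -> forall y, exists x, f x = y.
Proof.
move=> f2 y; have /ltnW/card_gt0P[x] := f2 y.
by rewrite inE => /eqP; exists x.
Qed.

Lemma norm_deriv0 X Y (f : gmap X Y) (a : admissible O f) :
  two_surjective f -> norm_deriv (R := R) a 0 = 0.
Proof.
move=> f2; rewrite /norm_deriv raddf0; apply: norm_surj0 => x.
have [x' [e n]] := two_surjective_other f2 x.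
have h := offdiag_pairP (esym e) (fun e' => n (esym e')).
by exists (exist _ (x, x') h).
Qed.

Section ExponentialOffDiagonal.
Variables (S X Y Z P : gset gT) (h : gmap S X) (f : gmap X Y) (q : gmap Z Y).
Variables (p : gmap P Z) (k : gmap P X) (e : gmap P S).
Hypothesis ex : is_exponential h f q p k e.

Let w1 := hpb1 (offdiag1 f) h.
Let w2 := hpb2 (offdiag1 f) h.
Let u := hcomp (offdiag2 f) w1.
Let v1 := hpb1 h u.
Let v2 := hpb2 h u.

Let pb : is_pullback f q p k. Proof. by case: ex. Qed.
Let he w : h (e w) = k w. Proof. by case: ex. Qed.

Lemma expo_offdiag_sq (d : offdiag p) : f (k (offdiag1 p d)) = f (k (offdiag2 p d)).
Proof. by case: pb => sq _; rewrite !sq offdiag_sq. Qed.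

Lemma expo_offdiag_neq (d : offdiag p) : k (offdiag1 p d) <> k (offdiag2 p d).
Proof.
move=> ek; case: (offdiag_neq (p := d)).
exact: pullback_inj pb _ _ ek (offdiag_sq d).
Qed.

Let g : gmap (offdiag p) (offdiag f) :=
  @offdiag_pair _ _ _ _ f (hcomp k (offdiag1 p)) (hcomp k (offdiag2 p))
    expo_offdiag_sq expo_offdiag_neq.

Let expo_k : gmap (offdiag p) (hpb (offdiag1 f) h) :=
  hpb_lift (offdiag1 f) h g (hcomp e (offdiag1 p)) (fun d => esym (he _)).

Let expo_e : gmap (offdiag p) (hpb h u) :=
  hpb_lift h u (hcomp e (offdiag2 p)) expo_k (fun d => he _).

(** A point of hpb (offdiag1 f) h over s0 in S is a point other than h s0 in the
  fibre of f through h s0.  A section of h over these points extends uniquely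
  by s0 to a section over the whole fibre, that is, to a point of P over s0. *)
Lemma expo_offdiagP : is_exponential v2 w2 e (offdiag1 p) expo_k expo_e.
Proof.
have [sq un] := pb; have inj := pullback_inj pb.
have [_ _ ev] := ex.
split=> //.
  split=> // w x ewx.
  have kx : k x = offdiag1 f (w1 w) by rewrite -he -ewx -[RHS](esym (hpb_sq w)).
  have [x' [[kx' px'] _]] : exists! x', k x' = offdiag2 f (w1 w) /\ p x' = p x.
    by apply: un; rewrite -offdiag_sq -kx.
  have nx : x <> x'.
    by move=> exx; case: (offdiag_neq (p := w1 w)); rewrite -kx -kx' exx.
  exists (exist _ (x, x') (offdiag_pairP (esym px') nx)); split.
    split=> //; apply: hpb_eq; last exact: esym ewx.
    by apply: offdiag_eq; rewrite /= ?kx ?kx'.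
  move=> d [d1 d2]; apply: offdiag_eq; first exact: esym d2.
  apply: inj; first by rewrite kx' -d1.
  by rewrite px' -d2 offdiag_sq.
move=> s0 s sP.
have w1E (w : {w | w2 w == s0}) : offdiag1 f (w1 (val w)) = h s0.
  by have sqw := hpb_sq (val w); rewrite (eqP (valP w)) in sqw.
(* s' is the section over the whole fibre: s0 at h s0, and s elsewhere *)
have /choice[s' s'P] : forall t : {x | f x == f (h s0)}, exists st : S,
    [/\ h st = val t, val t = h s0 -> st = s0
      & forall w : {w | w2 w == s0}, u (val w) = val t -> v1 (s w) = st].
  case=> x hx; have [exs|n] := x =P h s0.
    exists s0; split=> // w ew; case: (offdiag_neq (p := w1 (val w))).
    by rewrite w1E -exs; exact: esym ew.
  have ho : (f (h s0) == f x) && (h s0 != x).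
    by rewrite eq_sym hx /=; apply/eqP => /esym.
  have hw : offdiag1 f (exist _ (h s0, x) ho, s0).1 ==
            h (exist _ (h s0, x) ho : offdiag f, s0).2 by [].
  pose w : hpb (offdiag1 f) h := exist _ (exist _ (h s0, x) ho : offdiag f, s0) hw.
  have ww : w2 w == s0 by [].
  exists (v1 (s (exist _ w ww))); split=> //.
    by rewrite [LHS]hpb_sq [hpb2 _ _ _]sP.
  move=> w' ew'; congr (v1 (s _)); apply: val_inj; apply: hpb_eq.
    apply: offdiag_eq; last exact: ew'.
    exact: w1E.
  exact/eqP/(valP w').
have [z [[qz zP] zU]] := ev (f (h s0)) s' (fun t => let: And3 a _ _ := s'P t in a).
have [x [[kx px] xU]] := un (h s0) z (esym qz).
have es0 : e x = s0.
  rewrite (zP x (exist _ (h s0) (eqxx _)) px kx).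
  by case: (s'P (exist _ (h s0) (eqxx _))) => _ /= ->.
exists x; split.
  split=> // d w ed ek; apply: hpb_eq; last by rewrite [RHS]sP -ek.
  have hd : f (k (offdiag2 p d)) == f (h s0).
    by rewrite -expo_offdiag_sq ed kx.
  pose t : {x | f x == f (h s0)} := exist _ (k (offdiag2 p d)) hd.
  have [_ _ /(_ w)] := s'P t; rewrite -ek => /(_ erefl) ->.
  by rewrite -(zP (offdiag2 p d) t) // -offdiag_sq ed.
move=> x' [ex' x'P]; apply: xU; have kx' : k x' = h s0 by rewrite -he ex'.
split=> //; apply/esym/zU; split; first by rewrite -sq kx'.
move=> w t pw kw; have [wx|n] := w =P x'.
  rewrite wx ex'; case: (s'P t) => _ -> //.
  by rewrite -kw wx.
pose d : offdiag p := exist _ (x', w) (offdiag_pairP (esym pw) (fun e' => n (esym e'))).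
have wd : w2 (expo_k d) == s0 by apply/eqP.
pose v : {w | w2 w == s0} := exist _ (expo_k d) wd.
have := x'P d v erefl erefl.
by move/(congr1 (fun r => v1 r)) => ed; have [_ _ /(_ v) <-] := s'P t.
Qed.

(** By base change the left side is the norm, along a map into S, of a transfer;
  Tambara reciprocity applies to it with the exponential diagram of
  expo_offdiagP. *)
Lemma norm_deriv_tr (af : admissible O f) (ap : admissible O p) (b : R S) :
  mk_res R h (norm_deriv af (mk_tr R h b)) =
  mk_tr R e (norm_deriv ap (mk_res R e b)).
Proof.
have pbw := hpbP (offdiag1 f) h.
have aw := admissible_pullback pbw (offdiag1_admissible af).
rewrite /norm_deriv (norm_dc ax pbw _ aw) -mk_res_comp (mk_dc (hpbP h u)).
rewrite (norm_tr ax expo_offdiagP aw (offdiag1_admissible ap)).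
by congr (mk_tr R e (tb_norm R _ _)); rewrite -[RHS]mk_res_comp; apply: mk_res_compE.
Qed.
End ExponentialOffDiagonal.
End NormDerivativeTransfer.

(** * Square-zero extensions *)

Section SquareZero.
Local Open Scope ring_scope.
Variables (gT : finGroupType) (O : indexing_system gT) (A : tambara O).
Variables (B : calg A) (M : gmod (u_ob B)).
Local Notation Bt := (u_ob B : tambara O).
Let bax := tb_ax Bt.

Lemma sqz_normE X Y (f : gmap X Y) (a : admissible O f)
    (x : sqz_green (B := B) M X) :
  sqz_norm a x =
    (tb_norm Bt a x.1, mk_tr M f (gm_act (norm_deriv a x.1) x.2)).
Proof. by []. Qed.

Lemma sqz_axioms : tambara_axioms (@sqz_norm gT O A B M).
Proof.
split.
- move=> X a [b m]; rewrite sqz_normE /= (norm_id bax) norm_deriv_inj //.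
  by rewrite gm_act1 mk_tr_id.
- move=> X Y Z g f ag af agf [b m]; rewrite !sqz_normE /= (norm_comp bax ag af).
  congr pair; rewrite (norm_deriv_comp ag af) // -gm_actA.
  by rewrite mk_tr_comp (dp_frobr (gm_dp M)).
- move=> X Y f a; rewrite sqz_normE /= (norm1 bax) (dp_0r (gm_dp M)).
  by rewrite raddf0.
- move=> X Y f a [b m] [c n]; rewrite !sqz_normE /= (normM bax).
  congr pair; rewrite !(dp_frobr (gm_dp M)) -raddfD /= !res_norm norm_derivM.
  rewrite (dp_Dr (gm_dp M)); congr (mk_tr M f (_ + _)); rewrite !gm_actA.
    by rewrite [in LHS]gr_mulC gr_mulA.
  by rewrite [in LHS]gr_mulC (gr_mulC (norm_deriv a b)) gr_mulA.
- move=> X a [b m]; rewrite sqz_normE /= (norm_fold bax); congr pair.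
  rewrite norm_deriv_fold.
  rewrite (mk_tr_split (q1 := hid X) (q2 := hid X) _ (complementary_sum X X)) //.
  rewrite !mk_tr_id !(dp_res (gm_dp M)) [LHS]addrC.
  by congr (gm_act _ _ + gm_act _ _); apply: mk_res_compE.
- move=> X Y Z W f g f' g' pb a a' [b m]; rewrite !sqz_normE /=.
  rewrite (norm_dc bax pb a a'); congr pair.
  by rewrite (mk_dc pb) (dp_res (gm_dp M)) (res_norm_deriv a a' _ pb).
move=> S X Y Z P h f q p k e ex af ap [b m]; rewrite !sqz_normE /=.
rewrite (norm_tr bax ex af ap); congr pair.
rewrite (dp_frobr (gm_dp M)) (norm_deriv_tr ex af ap) (dp_frobl (gm_dp M)).
have [[sq _] he _] := ex.
rewrite (mk_tr_compE (h := k)) // (mk_tr_compE (h := hcomp f k)) //.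
by rewrite (mk_tr_compE (h := hcomp f k)) => [|t] /=.
Qed.

Lemma sqz_kernel_norms_vanish (ax : tambara_axioms (@sqz_norm gT O A B M)) :
  kernel_norms_vanish (sqz_ab ax).
Proof.
move=> X Y f a f2 [b m] /= b0; have {}b0 : b = 0 by exact: b0.
rewrite b0.
apply: etrans (sqz_normE a (0, m)) _ => /=.
rewrite norm_deriv0 // (dp_0l (gm_dp M)) raddf0.
by rewrite norm_surj0 //; exact: two_surjective_surj.
Qed.
End SquareZero.

(** * The norm of a sum *)

Section FoldExponential.
Variables (gT : finGroupType) (X Y : gset gT) (f : gmap X Y).

Let inside (z : hprod Y (hpow X)) := (z.2 : {set X}) \subset [pred x | f x == z.1].

Lemma inside_stable z a : inside (hact z a) = inside z.
Proof.
rewrite /inside hact_prodE /= hact_powE.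
apply/subsetP/subsetP => h x hx.
  have := h (hact x a); rewrite (mem_imset _ _ (@hact_inj _ X a)).
  by rewrite hx !inE gmapE (inj_eq (@hact_inj _ _ a)) => ->.
case/imsetP: hx => t ht ->; have := h t ht.
by rewrite !inE gmapE (inj_eq (@hact_inj _ _ a)).
Qed.

(** Sections of the fold map over a fibre of f are subsets of that fibre (the
  points sent to the second summand), so the dependent product of the fold map
  along f is the G-set of subsets of fibres. *)
Definition fibre_sets : gset gT := hsub inside_stable.
Definition fibre_base : gmap fibre_sets Y :=
  hcomp (hfst Y (hpow X)) (hsub_val inside_stable).
Definition fibre_set (z : fibre_sets) : {set X} := (val z).2.

Lemma fibre_set_base z x : x \in fibre_set z -> f x = fibre_base z.
Proof. by move=> hx; have /subsetP/(_ _ hx) := valP z; rewrite inE => /eqP. Qed.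

Lemma fibre_sets_eq z t :
  fibre_base z = fibre_base t -> fibre_set z = fibre_set t -> z = t.
Proof. by case: z t => [[y U] h] [[y' U'] h'] /= e1 e2; apply: val_inj; congr pair. Qed.

Lemma mk_fibre_set_subproof y (U : {set X}) :
  (forall x, x \in U -> f x = y) -> inside (y, U).
Proof. by move=> h; apply/subsetP => x /h; rewrite inE => ->. Qed.

Definition mk_fibre_set y (U : {set X}) (h : forall x, x \in U -> f x = y) :
  fibre_sets := exist _ (y, U) (mk_fibre_set_subproof h).

Lemma mem_hact_fibre_set z x a :
  (hact x a \in fibre_set (hact z a)) = (x \in fibre_set z).
Proof.
rewrite /fibre_set mk_hsetE // (val_hsub_act inside_stable) hact_prodE.
exact: mem_hact_pow.
Qed.

Lemma fibre_set_hact z a : fibre_set (hact z a) = [set hact x a | x in fibre_set z].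
Proof.
by rewrite /fibre_set mk_hsetE // (val_hsub_act inside_stable) hact_prodE /= hact_powE.
Qed.

Lemma card_fibre_set_hact z a : #|fibre_set (hact z a)| = #|fibre_set z|.
Proof. by rewrite fibre_set_hact card_imset //; exact: hact_inj. Qed.

Definition fibre_pts : gset gT := hpb f fibre_base.
Definition fibre_pt : gmap fibre_pts X := hpb1 f fibre_base.
Definition fibre_over : gmap fibre_pts fibre_sets := hpb2 f fibre_base.

Definition in_fibre_set (w : fibre_pts) : bool :=
  fibre_pt w \in fibre_set (fibre_over w).

Lemma in_fibre_set_stable w a : in_fibre_set (hact w a) = in_fibre_set w.
Proof. by rewrite /in_fibre_set !gmapE mem_hact_fibre_set. Qed.

Lemma notin_fibre_set_stable w a : ~~ in_fibre_set (hact w a) = ~~ in_fibre_set w.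
Proof. by rewrite in_fibre_set_stable. Qed.

Definition fibre_eval_fun (w : fibre_pts) : hsum X X :=
  if in_fibre_set w then inr (fibre_pt w) else inl (fibre_pt w).

Lemma fibre_evalP w a : a \in [set: gT]%G ->
  fibre_eval_fun (hact w a) = hact (fibre_eval_fun w) a.
Proof.
move=> _; rewrite /fibre_eval_fun in_fibre_set_stable hact_sumE gmapE.
by case: (in_fibre_set w).
Qed.

Definition fibre_eval : gmap fibre_pts (hsum X X) := HMap fibre_evalP.

Lemma fold_exponential :
  is_exponential (hfold X) f fibre_base fibre_over fibre_pt fibre_eval.
Proof.
split=> [|w|y s sP]; first exact: hpbP.
  by rewrite /= /fibre_eval_fun; case: (in_fibre_set w).
have sE x : s x = inl (val x) \/ s x = inr (val x).
  by rewrite -(sP x); case: (s x) => t; [left|right].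
pose U := [set x : X | if insub x is Some t then s t == inr x else false].
have memU (t : {x | f x == y}) : (val t \in U) = (s t == inr (val t)).
  by rewrite inE valK.
have hU x : x \in U -> f x = y.
  by rewrite inE; case: insubP => // t ft _ _; exact/eqP.
exists (mk_fibre_set hU); split.
  split=> // w x ew ex; rewrite /= /fibre_eval_fun /in_fibre_set ew ex memU.
  by case: (sE x) => ->; rewrite ?eqxx.
move=> z [qz zP]; apply: fibre_sets_eq; first by rewrite qz.
apply/setP => x; case: (f x =P y) => [fx|n]; last first.
  transitivity false; first by apply/negbTE/negP => /hU.
  by apply/esym/negbTE/negP => /fibre_set_base; rewrite qz.
have fx' : f x == y by exact/eqP.
have hw : f (x, z).1 == fibre_base (x, z).2 by rewrite qz.
pose t : {x | f x == y} := exist _ x fx'.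
pose w : fibre_pts := exist _ (x, z) hw.
change ((val t \in U) = in_fibre_set w).
have := zP w t erefl erefl; rewrite memU /= /fibre_eval_fun.
by case: ifP => _ <-; rewrite ?eqxx.
Qed.
End FoldExponential.

Section NormOfSum.
Local Open Scope ring_scope.
Variables (gT : finGroupType) (O : indexing_system gT) (R : tambara O).
Variables (X Y : gset gT) (f : gmap X Y) (a : admissible O f).
Let ax := tb_ax R.

Let base := fibre_base f.
Let over := fibre_over f.
Let pt := fibre_pt f.

Lemma empty_map_subproof (y : Y) (c : gT) : c \in [set: gT]%G ->
  (set0 : hpow X) = hact (set0 : hpow X) c :> {set X}.
Proof. by rewrite hact_powE imset0. Qed.

Lemma single_map_subproof (x : X) (c : gT) : c \in [set: gT]%G ->
  ([set hact x c] : hpow X) = hact ([set x] : hpow X) c :> {set X}.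
Proof. by rewrite hact_powE imset_set1. Qed.

Let empty_map : gmap Y (hpow X) :=
  @HMap gT _ Y (hpow X) (fun=> set0) empty_map_subproof.
Let single_map : gmap X (hpow X) :=
  @HMap gT _ X (hpow X) (fun x => [set x]) single_map_subproof.

Lemma empty_inside y : (hpair (hid Y) empty_map y).2 \subset
  [pred x | f x == (hpair (hid Y) empty_map y).1].
Proof. by apply/subsetP => x; rewrite inE. Qed.

Lemma single_inside x : (hpair f single_map x).2 \subset
  [pred x' | f x' == (hpair f single_map x).1].
Proof. by apply/subsetP => x' /set1P ->; rewrite inE. Qed.

(* the empty subsets and the singletons; j2 below includes all the others *)
Let j0 : gmap Y (fibre_sets f) := hsub_lift (@inside_stable _ _ _ f) empty_inside.
Let j1 : gmap X (fibre_sets f) := hsub_lift (@inside_stable _ _ _ f) single_inside.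

Let nonempty (z : fibre_sets f) := fibre_set z != set0.
Let several (z : fibre_sets f) := (1 < #|fibre_set z|)%N.

Lemma nonempty_stable z c : nonempty (hact z c) = nonempty z.
Proof. by rewrite /nonempty -!card_gt0 card_fibre_set_hact. Qed.

Lemma several_stable z c : several (hact z c) = several z.
Proof. by rewrite /several card_fibre_set_hact. Qed.

Let j' := hsub_val nonempty_stable.
Let several' (z : hsub nonempty_stable) := several (j' z).
Lemma several'_stable z c : several' (hact z c) = several' z.
Proof. by rewrite /several' gmapE several_stable. Qed.
Let j2' := hsub_val several'_stable.
Let j2 := hcomp j' j2'.

Lemma j1_nonempty x : nonempty (j1 x).
Proof. by rewrite /nonempty -card_gt0 /fibre_set /= cards1. Qed.
Let j1' := hsub_lift nonempty_stable j1_nonempty.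

Lemma compl_empty : complementary j0 j'.
Proof.
split=> [y y' /(congr1 val) [] //|z t|y [z hz] e|z]; first exact: val_inj.
  by have /negP[] := hz; rewrite -[z]e.
case: (boolP (nonempty z)) => hz; [right|left]; first by exists (exist _ z hz).
exists (base z); apply: fibre_sets_eq => //.
by move: hz; rewrite /nonempty negbK => /eqP ->.
Qed.

Lemma compl_single : complementary j1' j2'.
Proof.
split=> [x x' /(congr1 val)/(congr1 (@fibre_set _ _ _ _))/set1_inj //|z t|x [z hz] e|z].
- exact: val_inj.
- by have := hz; rewrite -[z]e /several' /several /fibre_set /= cards1.
case: (boolP (several' z)) => hz; [right|left]; first by exists (exist _ z hz).
have : #|fibre_set (val z)| == 1%N.
  by rewrite eqn_leq leqNgt hz card_gt0; exact: (valP z).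
case/cards1P => x ex; exists x; apply: val_inj; apply: fibre_sets_eq => //.
by rewrite /= (fibre_set_base (z := val z)) // ex set11.
Qed.

Let outer := hsub_val (notin_fibre_set_stable (f := f)).
Let inner := hsub_val (in_fibre_set_stable (f := f)).

Let over_outer := hcomp over outer.
Let over_inner := hcomp over inner.

Let a_over : admissible O over := admissible_pullback (hpbP f base) a.
Let a_outer : admissible O over_outer.
Proof.
by apply: (@admissible_restrict _ O _ _ _ over outer) => //; exact: val_inj.
Qed.
Let a_inner : admissible O over_inner.
Proof.
by apply: (@admissible_restrict _ O _ _ _ over inner) => //; exact: val_inj.
Qed.

Variables b x : R X.

(** Over a subset U of a fibre, the product of x over U and of b outside U. *)
Let summand : R (fibre_sets f) :=
  gr_mul (tb_norm R a_outer (mk_res R (hcomp pt outer) b))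
         (tb_norm R a_inner (mk_res R (hcomp pt inner) x)).

(** b + x is the transfer of (b, x) along the fold map of X, so reciprocity
  applies with fold_exponential. *)
Lemma norm_add_fibre_sets : tb_norm R a (b + x) = mk_tr R base summand.
Proof.
have [y [[yb yx] _]] := mk_sum b x.
have -> : b + x = mk_tr R (hfold X) y.
  rewrite (mk_tr_split (q1 := hid X) (q2 := hid X) _ (complementary_sum X X)) //.
  by rewrite !mk_tr_id yb yx.
rewrite (norm_tr ax (fold_exponential f) a a_over); congr mk_tr.
have oi : complementary inner outer.
  exact: complementary_sub.
rewrite (norm_split a_over a_inner a_outer _ oi) // gr_mulC /summand -yb -yx.
rewrite -!mk_res_comp; congr gr_mul; congr tb_norm; congr mk_res.
  by apply: hmap_eq => -[w hw] /=; rewrite /fibre_eval_fun (negPf hw).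
by apply: hmap_eq => -[w hw] /=; rewrite /fibre_eval_fun [in_fibre_set w]hw.
Qed.

(** The empty subset of a fibre contributes the constant term. *)
Lemma res_summand_empty : mk_res R j0 summand = tb_norm R a b.
Proof.
have e0 t : f (hid X t) = base (hcomp j0 f t) by [].
have n0 t : ~~ in_fibre_set (hpb_lift f base _ _ e0 t).
  by rewrite /in_fibre_set /fibre_set inE.
have pb : is_pullback over_outer j0 f (hsub_lift (notin_fibre_set_stable (f := f)) n0).
  split=> // -[w hw] y e.
  have fw : f (pt w) = y by rewrite hpb_sq [fibre_over f w]e.
  exists (pt w); split=> [|t [/(congr1 (fun w => pt (val w)))]//].
  by split=> //; apply: val_inj; apply: hpb_eq => //; rewrite [RHS]e -fw.
have a0 : admissible O (hvoid Y) by apply: admissible_inj.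
have pb' : is_pullback over_inner j0 (hvoid Y) (hvoid _).
  split=> [[]|[w hw] y e]; have := hw.
  by rewrite /in_fibre_set [fibre_over f w]e /fibre_set inE.
rewrite /summand (dp_res (gr_dp R)) (norm_dc ax pb _ a) (norm_dc ax pb' _ a0).
rewrite [X in gr_mul _ X]norm_empty ?gr_mulr1; last by case.
by congr tb_norm; rewrite (mk_res_compE (h := hid X)) ?mk_res_id.
Qed.

(** Singletons contribute the linear term: the complement of {t} in its fibre
  consists of the points t' such that (t, t') is off the diagonal. *)
Lemma res_summand_single : mk_res R j1 summand = gr_mul (norm_deriv a b) x.
Proof.
have e1 d : f (offdiag2 f d) = base (hcomp j1 (offdiag1 f) d).
  exact/esym/offdiag_sq.
have n1 d : ~~ in_fibre_set (hpb_lift f base _ _ e1 d).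
  by rewrite /in_fibre_set /fibre_set inE eq_sym; exact/eqP/offdiag_neq.
have pb : is_pullback over_outer j1 (offdiag1 f)
    (hsub_lift (notin_fibre_set_stable (f := f)) n1).
  split=> // -[w hw] t e.
  have fw : f t = f (pt w) by rewrite hpb_sq [fibre_over f w]e.
  have nw : t <> pt w.
    move=> ew; have /negP[] := hw.
    rewrite /in_fibre_set [fibre_over f w]e /fibre_set inE.
    exact/eqP/esym.
  exists (exist _ (t, pt w) (offdiag_pairP fw nw)); split.
    by split=> //; apply: val_inj; apply: hpb_eq => //; exact: esym e.
  move=> d [/(congr1 (fun w => pt (val w))) d2 d1].
  by apply: offdiag_eq; rewrite /= ?d1 -?d2.
have e2 t : f (hid X t) = base (j1 t) by [].
have n2 t : in_fibre_set (hpb_lift f base _ _ e2 t).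
  by rewrite /in_fibre_set /fibre_set inE.
have a1 : admissible O (hid X) by apply: admissible_inj.
have pb' : is_pullback over_inner j1 (hid X)
    (hsub_lift (in_fibre_set_stable (f := f)) n2).
  split=> // -[w hw] t e.
  have tw : pt w = t.
    by have := hw; rewrite /in_fibre_set [fibre_over f w]e /fibre_set inE => /eqP.
  exists t; split=> [|t' [_ //]].
  by split=> //; apply: val_inj; apply: hpb_eq => //; exact: esym e.
rewrite /summand (dp_res (gr_dp R)) (norm_dc ax pb _ (offdiag1_admissible a)).
rewrite (norm_dc ax pb' _ a1) norm_idE //; congr gr_mul.
  by congr tb_norm; apply: mk_res_compE.
by rewrite (mk_res_compE (h := hid X)) ?mk_res_id.
Qed.

Hypothesis x_vanish : forall (U V : gset gT) (g : gmap U V) (u : gmap U X)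
  (ag : admissible O g), two_surjective g -> tb_norm R ag (mk_res R u x) = 0.

(** The inner factor is a norm along a 2-surjective map. *)
Lemma res_summand_several : mk_res R j2 summand = 0.
Proof.
have pb := hpbP over_inner j2; have a2 := admissible_pullback pb a_inner.
rewrite /summand (dp_res (gr_dp R)) (norm_dc ax pb a_inner a2) -mk_res_comp.
rewrite x_vanish ?(dp_0r (gr_dp R)) // => z.
have /card_gt1P[u [v [uz vz nuv]]] : (1 < #|fibre_set (j2 z)|)%N by exact: (valP z).
have pt_in t : t \in fibre_set (j2 z) -> exists2 w, hpb2 over_inner j2 w = z
    & pt (val (hpb1 over_inner j2 w)) = t.
  move=> tz; have ht : f (t, j2 z).1 == base (t, j2 z).2.
    by apply/eqP; exact: fibre_set_base.
  have ht' : in_fibre_set (exist _ (t, j2 z) ht : fibre_pts f) by [].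
  pose w : hsub (in_fibre_set_stable (f := f)) := exist _ (exist _ (t, j2 z) ht) ht'.
  have hw : over_inner (w, z).1 == j2 (w, z).2 by [].
  by exists (exist _ (w, z) hw).
have [u' u'z u'E] := pt_in u uz; have [v' v'z v'E] := pt_in v vz.
apply/card_gt1P; exists u', v'; rewrite !inE u'z v'z; split=> //.
by apply: contra_neq nuv => e; rewrite -u'E -v'E e.
Qed.

(** The expansion of the norm of a sum over all subsets of the fibres reduces to
  the subsets with at most one point. *)
Lemma norm_add :
  tb_norm R a (b + x) = tb_norm R a b + mk_tr R f (gr_mul (norm_deriv a b) x).
Proof.
rewrite norm_add_fibre_sets.
rewrite (mk_tr_split (q1 := hid Y) (q2 := hcomp base j') _ compl_empty) //.
rewrite mk_tr_id res_summand_empty; congr (_ + _).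
rewrite (mk_tr_split (q1 := f) (q2 := hcomp base j2) _ compl_single) //.
rewrite !(mk_res_compE (h := j2)) // res_summand_several raddf0 addr0.
by rewrite (mk_res_compE (h := j1)) // res_summand_single.
Qed.
End NormOfSum.

(** * The augmentation ideal of a square-zero extension *)

Section AugmentationIdealSquareZero.
Local Open Scope ring_scope.
Variables (gT : finGroupType) (O : indexing_system gT) (A : tambara O).
Variable B : calg A.
Local Notation Bt := (u_ob B : tambara O).
Hypothesis ax : forall M : gmod Bt, tambara_axioms (@sqz_norm gT O A B M).
Variable M : gmod Bt.

Let K : gmod Bt := aug_ideal (sqz_ab (ax M)).

Let elt X (x : K X) : Bt X * M X := kerz_val x.

Lemma elt1 X (x : K X) : (elt x).1 = 0.
Proof. exact: (kerz0 x). Qed.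

Program Definition sqz_ideal_to : gmod_hom K M :=
  GModHom (@MkMap gT K M (fun X x => (elt x).2) _ _ _) _.
Next Obligation. by []. Qed.
Next Obligation. by []. Qed.
Next Obligation. by []. Qed.
Next Obligation.
move=> X b x.
change (gm_act b (elt x).2 + gm_act (elt x).1 (0 : M X) = gm_act b (elt x).2).
by rewrite (dp_0r (gm_dp M)) addr0.
Qed.

Lemma sqz_ideal_from_subproof X (m : M X) :
  ((0, m) : total (sqz_ab (ax M)) X) \in
  kerp (@mkm_fun gT _ _ (augmentation (sqz_ab (ax M))) X).
Proof. exact: kerzE. Qed.

Program Definition sqz_ideal_from : gmod_hom M K :=
  GModHom (@MkMap gT M K (fun X m => Kerz (sqz_ideal_from_subproof m)) _ _ _) _.
Next Obligation. by move=> X m n; apply: val_inj; congr pair; rewrite subr0. Qed.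
Next Obligation. by move=> X Y f m; apply: val_inj; congr pair; rewrite raddf0. Qed.
Next Obligation. by move=> X Y f m; apply: val_inj; congr pair; rewrite raddf0. Qed.
Next Obligation.
move=> X b m; apply: val_inj; congr pair => /=.
  by rewrite (dp_0r (gr_dp Bt)).
by rewrite (dp_0r (gm_dp M)) addr0.
Qed.

Lemma sqz_ideal_toK X (x : K X) : sqz_ideal_from X (sqz_ideal_to X x) = x.
Proof.
apply: val_inj; change ((0, (elt x).2) = elt x).
by rewrite -(elt1 x) -surjective_pairing.
Qed.

End AugmentationIdealSquareZero.

(** * Abelian group objects are square-zero extensions *)

Section AbelianGroupObjects.
Local Open Scope ring_scope.
Variables (gT : finGroupType) (O : indexing_system gT) (A : tambara O).
Variable B : calg A.
Local Notation Bt := (u_ob B : tambara O).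
Local Notation P := (calg_over_products B).

(** The inverse of a bijective homomorphism is automatically compatible with all
  the structure, including the group law. *)
Lemma calg_ab_iso (R S : calg_ab B) (u : hom R S)
    (g : forall X, total S X -> total R X) :
  (forall X, cancel (total_map u X) (g X)) ->
  (forall X, cancel (g X) (total_map u X)) ->
  {v : hom S R | comp u v = idm S & comp v u = idm R}.
Proof.
move=> uK gK; have inj X : injective (total_map u X) := can_inj (uK X).
have gB X : zmod_morphism (g X) by move=> x y; apply: inj; rewrite raddfB /= !gK.
have g_res X Y (f : gmap X Y) x :
    g X (mk_res (total S) f x) = mk_res (total R) f (g Y x).
  by apply: inj; rewrite mkm_res !gK.
have g_tr X Y (f : gmap X Y) x :
    g Y (mk_tr (total S) f x) = mk_tr (total R) f (g X x).
  by apply: inj; rewrite mkm_tr !gK.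
pose m := MkMap gB g_res g_tr.
have m1 X : m X (gr_one (total S) X) = gr_one (total R) X.
  by apply: inj; rewrite /= tbm_1 gK.
have mM X (x y : total S X) : m X (gr_mul x y) = gr_mul (m X x) (m X y).
  by apply: inj; rewrite /= tbm_M !gK.
have mN X Y (f : gmap X Y) (a : admissible O f) x :
    m Y (tb_norm (total S) a x) = tb_norm (total R) a (m X x).
  by apply: inj; rewrite /= tbm_N !gK.
pose t := TbMap m1 mM mN.
have tu : comp (c := tambara_cat O) t (u_map (o_ob (ab_car S))) = u_map (o_ob (ab_car R)).
  apply: tbm_eq => X x; apply: inj; rewrite /= gK.
  exact/esym/(tbm_app (under_funP (over_fun (ab_fun u)))).
pose w : hom (o_ob (ab_car S)) (o_ob (ab_car R)) :=
  @UnderHom (tambara_cat O) A (o_ob (ab_car S)) (o_ob (ab_car R)) t tu.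
have wP : comp (o_map (ab_car R)) w = o_map (ab_car S).
  apply: under_eq; apply: tbm_eq => X x.
  by have := total_map_aug u (g X x); rewrite gK.
pose v : hom (ab_car S) (ab_car R) := @OverHom (calg A) B (ab_car S) (ab_car R) w wP.
have uv : comp (ab_fun u) v = idm _ by apply: over_tbmap_inj => X x; exact: gK.
have vu : comp v (ab_fun u) = idm _ by apply: over_tbmap_inj => X x; exact: uK.
have vP : comp v (ab_add S) =
    comp (ab_add R) (pair_hom P (comp v (pr1 P _ _)) (comp v (pr2 P _ _))).
  rewrite -[RHS]comp_idl -vu -compA; congr (comp v _).
  rewrite compA (ab_funP u) -compA pair_comp -!compA pair_hom1 pair_hom2.
  rewrite !compA uv !comp_idl -[LHS]comp_idr; congr (comp _ _).
  by apply: (@pair_ext _ P); rewrite comp_idr ?pair_hom1 ?pair_hom2.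
by exists (AbHom v vP); apply: ab_hom_eq.
Qed.

Section Decomposition.
Variable R : calg_ab B.
Local Notation s := (zero_section R).
Local Notation aug := (augmentation R).

(** The group law is additive on the fibre product over B, and there
  (x, y) = (x, s aug x) + (s aug y, y) - (s aug x, s aug x), where the unit law
  computes the value at each of the three terms. *)
Lemma ab_add_total X (z : over_tambara (prod_ob P (ab_car R) (ab_car R)) X) :
  over_tbmap (ab_add R) X z =
  (over_prod_val z).1 + (over_prod_val z).2 - s X (aug X (over_prod_val z).1).
Proof.
have zP := over_prodP z.
set x := (over_prod_val z).1 in zP *; set y := (over_prod_val z).2 in zP *.
pose id_R : hom (ab_car R) (ab_car R) := idm _.
pose zero : hom (ab_car R) (ab_car R) := comp (ab_zero R) (bang P _).
pose u := pair_hom P id_R zero; pose v := pair_hom P zero id_R.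
have uE w : over_tbmap (ab_add R) X (over_tbmap u X w) = w.
  by rewrite -over_tbmap_comp (gel_addr0 (x := R)).
have vu : v = comp (pair_hom P (pr2 P _ _) (pr1 P _ _)) u.
  by rewrite pair_comp pair_hom1 pair_hom2.
have vE w : over_tbmap (ab_add R) X (over_tbmap v X w) = w.
  by rewrite vu -over_tbmap_comp compA ab_addC over_tbmap_comp uE.
have zE : z = over_tbmap u X x + over_tbmap v X y - over_tbmap u X (s X (aug X x)).
  apply: val_inj; apply: (etrans (surjective_pairing _)).
  rewrite -[val z]/(over_prod_val z) -/x -/y.
  congr pair.
    change (x = x + s X (aug X y) - s X (aug X x)).
    by rewrite [aug X x]zP addrK.
  change (y = s X (aug X x) + y - s X (aug X (s X (aug X x)))).
  by rewrite zero_sectionK [LHS](esym (addKr (s X (aug X x)) y)) addrC.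
have addE p q r : over_tbmap (ab_add R) X (p + q - r) =
    over_tbmap (ab_add R) X p + over_tbmap (ab_add R) X q - over_tbmap (ab_add R) X r.
  by rewrite raddfB raddfD.
apply: (etrans (congr1 _ zE)); apply: (etrans (addE _ _ _)).
by congr (_ + _ - _); [exact: uE|exact: vE|exact: uE].
Qed.

Hypothesis van : kernel_norms_vanish R.

(** The product is the norm of (x, y) along the fold map, which is 2-surjective. *)
Lemma kernel_mul0 X (x y : total R X) :
  aug X x = 0 -> aug X y = 0 -> gr_mul x y = 0.
Proof.
move=> x0 y0; have [z [[zx zy] _]] := mk_sum x y.
have az := @admissible_fold _ O X.
rewrite -zx -zy -(norm_fold (tb_ax (total R)) az); apply: van.
  move=> t; apply/card_gt1P; exists (inl t), (inr t).
  by rewrite !inE /= !eqxx.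
by apply: mk_res_sum_inj; rewrite -!mkm_res ?zx ?zy ?x0 ?y0 !raddf0.
Qed.

(** s commutes with norms and restrictions, hence with norm_deriv, and the
  vanishing hypothesis is what norm_add requires. *)
Lemma norm_zero_section X Y (f : gmap X Y) (a : admissible O f) (b : Bt X)
    (x : total R X) : aug X x = 0 ->
  tb_norm (total R) a (s X b + x) = s Y (tb_norm Bt a b) +
    mk_tr (total R) f (gr_mul (s X (norm_deriv a b)) x).
Proof.
move=> x0; rewrite norm_add; last first.
  by move=> U V g u ag g2; apply: van => //; rewrite mkm_res x0 raddf0.
by rewrite /norm_deriv -mkm_res -!tbm_N.
Qed.

Hypothesis ax : forall M : gmod Bt, tambara_axioms (@sqz_norm gT O A B M).

Local Notation E := (sqz_ab (ax (aug_ideal R))).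

Let sum X (z : Bt X * aug_ideal R X) : total R X := s X z.1 + kerz_val z.2.

Let ker0 X (x : aug_ideal R X) : aug X (kerz_val x) = 0 := kerz0 x.

Let sum_aug X (z : Bt X * aug_ideal R X) : aug X (sum z) = z.1.
Proof. by rewrite raddfD /= zero_sectionK ker0 addr0. Qed.

Let sumB X : zmod_morphism (@sum X).
Proof. by move=> z t; rewrite /sum /= raddfB /= opprD addrACA. Qed.

Let sum_res X Y (f : gmap X Y) (z : Bt Y * aug_ideal R Y) :
  sum (mk_res Bt f z.1, mk_res (aug_ideal R) f z.2) = mk_res (total R) f (sum z).
Proof. by rewrite /sum raddfD /= mkm_res. Qed.

Let sum_tr X Y (f : gmap X Y) (z : Bt X * aug_ideal R X) :
  sum (mk_tr Bt f z.1, mk_tr (aug_ideal R) f z.2) = mk_tr (total R) f (sum z).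
Proof. by rewrite /sum raddfD /= mkm_tr. Qed.

Let sum_map : mkmap (total E) (total R) :=
  @MkMap gT (total E) (total R) sum sumB sum_res sum_tr.

Let sum1 X : sum_map X (gr_one (total E) X) = gr_one (total R) X.
Proof. by rewrite /= /sum /= tbm_1 addr0. Qed.

Let sumM X (z t : total E X) :
  sum_map X (gr_mul z t) = gr_mul (sum_map X z) (sum_map X t).
Proof.
rewrite /= /sum /= tbm_M.
rewrite !(dp_Dr (gr_dp (total R))) !(dp_Dl (gr_dp (total R))).
rewrite (kernel_mul0 (ker0 z.2) (ker0 t.2)) addr0 -!addrA.
by congr (_ + _); rewrite addrC [gr_mul (kerz_val _) _]gr_mulC.
Qed.

Let sumN X Y (f : gmap X Y) (a : admissible O f) (z : total E X) :
  sum_map Y (tb_norm (total E) a z) = tb_norm (total R) a (sum_map X z).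
Proof. by rewrite [RHS](norm_zero_section a z.1 (ker0 z.2)). Qed.

Let sum_tb : tbmap (total E) (total R) := TbMap sum1 sumM sumN.

Let sum_under : comp (c := tambara_cat O) sum_tb (u_map (o_ob (ab_car E))) =
  u_map (o_ob (ab_car R)).
Proof.
apply: tbm_eq => X x; rewrite /= /sum /= addr0.
exact: (tbm_app (under_funP (over_fun (ab_zero R)))).
Qed.

Let sum_calg : hom (o_ob (ab_car E)) (o_ob (ab_car R)) :=
  @UnderHom (tambara_cat O) A (o_ob (ab_car E)) (o_ob (ab_car R)) sum_tb sum_under.

Let sum_over : comp (o_map (ab_car R)) sum_calg = o_map (ab_car E).
Proof. by apply: under_eq; apply: tbm_eq => X z; exact: sum_aug. Qed.

Let sum_hom : hom (ab_car E) (ab_car R) :=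
  @OverHom (calg A) B (ab_car E) (ab_car R) sum_calg sum_over.

Let sum_ab : comp sum_hom (ab_add E) =
  comp (ab_add R) (pair_hom P (comp sum_hom (pr1 P _ _)) (comp sum_hom (pr2 P _ _))).
Proof.
apply: over_tbmap_inj => X z; have zP := over_prodP z.
pose w := over_tbmap
  (pair_hom P (comp sum_hom (pr1 P _ _)) (comp sum_hom (pr2 P _ _))) X z.
apply: (etrans _ (esym (ab_add_total w))).
set x := (over_prod_val z).1 in zP *; set y := (over_prod_val z).2 in zP *.
change (sum (x.1, x.2 + y.2) = sum x + sum y - s X (aug X (sum x))).
rewrite sum_aug /sum /=; have -> : y.1 = x.1 by exact: esym zP.
by rewrite [RHS]addrC addrA addrA addrACA addNr add0r -addrA addrCA.
Qed.

(** Adding an element of the augmentation ideal to the zero section identifies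
  R with a square-zero extension. *)
Definition sqz_ideal_sum : hom E R := AbHom sum_hom sum_ab.

Lemma sqz_ideal_sumE X (z : Bt X * aug_ideal R X) :
  total_map sqz_ideal_sum X z = s X z.1 + kerz_val z.2.
Proof. by []. Qed.

Lemma sqz_ideal_sum_iso :
  {v : hom R E | comp sqz_ideal_sum v = idm R & comp v sqz_ideal_sum = idm E}.
Proof.
have diff0 X (r : total R X) : aug X (r - s X (aug X r)) = 0.
  by rewrite raddfB /= zero_sectionK subrr.
pose g X (r : total R X) : total E X := (aug X r, Kerz (kerzE (diff0 X r))).
apply: (@calg_ab_iso _ _ _ g) => X.
  move=> z; rewrite sqz_ideal_sumE; apply/eqP; apply/andP; split.
    by apply/eqP; exact: sum_aug.
  apply/eqP/val_inj; rewrite /= (sum_aug z) /sum.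
  by rewrite addrC addKr.
by move=> r; rewrite sqz_ideal_sumE /= addrC subrK.
Qed.
End Decomposition.

Lemma sqz_ideal_sum_natural
    (ax : forall M : gmod Bt, tambara_axioms (@sqz_norm gT O A B M))
    (R S : calg_ab B) (vR : kernel_norms_vanish R) (vS : kernel_norms_vanish S)
    (u : hom R S) :
  comp (sqz_ideal_sum vS ax) (sqz_map ax (aug_ideal_map u)) =
  comp u (sqz_ideal_sum vR ax).
Proof.
apply: ab_hom_eq; rewrite !ab_compE; apply: over_tbmap_inj => X z.
rewrite !over_tbmap_comp.
change (zero_section S X z.1 + total_map u X (kerz_val z.2) =
  total_map u X (zero_section R X z.1 + kerz_val z.2)).
by rewrite raddfD /= total_map_zero.
Qed.
End AbelianGroupObjects.

Theorem proposition3p1p1 (gT : finGroupType) (O : indexing_system gT)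
    (A : tambara O) (B : calg A) :
  exists (ax : forall M : gmod (u_ob B), tambara_axioms (@sqz_norm gT O A B M))
         (van : forall M : gmod (u_ob B), kernel_norms_vanish (sqz_ab (ax M))),
    inverse_equivalences
      (@sqz_functor gT O A B ax van
         : functor (gmod_cat (u_ob B)) (calg_ab_vanishing B))
      (@aug_ideal_functor gT O A B
         : functor (calg_ab_vanishing B) (gmod_cat (u_ob B))).
Proof.
pose ax M := @sqz_axioms gT O A B M.
exists ax; exists (fun M => @sqz_kernel_norms_vanish gT O A B M (ax M)); split.
  exists (fun M => sqz_ideal_to ax M), (fun M => sqz_ideal_from ax M); split.
  - by move=> M; apply: gmod_hom_eq.
  - by move=> M; apply: gmod_hom_eq => X x; exact: sqz_ideal_toK.
  - by move=> M N u; apply: gmod_hom_eq.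
pose iso (R : calg_ab_vanishing B) := sqz_ideal_sum_iso (svalP R) ax.
exists (fun R => sqz_ideal_sum (svalP R) ax), (fun R => s2val (iso R)); split.
- by move=> R; exact: (s2valP (iso R)).
- by move=> R; exact: (s2valP' (iso R)).
- by move=> R S u; exact: sqz_ideal_sum_natural.
Qed.
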